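(* Let $(m,n)$ be an admissible couple of positive integers, let $\mathbf{Q}=\mathbf{Q}_{m,n}$ be the conformal $Q$-curvature increment operator on the standard sphere $(\mathbb{S}^n,g_0)$, and let $\Gamma(\mathbf{Q})=\{(u,\mathbf{Q}[u]) : u\in C^\infty(\mathbb{S}^n)\}$ be its graph in $C^\infty(\mathbb{S}^n)\times C^\infty(\mathbb{S}^n)$. For each $(u,q)\in C^\infty(\mathbb{S}^n)\times C^\infty(\mathbb{S}^n)$ and each conformal Killing vector field $X$ on $(\mathbb{S}^n,g_0)$: $$(u,q)\in\Gamma(\mathbf{Q})\implies \int_{\mathbb{S}^n}(X\cdot q)\,d\mu_u=0,$$ where $d\mu_u=e^{nu}d\mu_0$ is the Lebesgue measure of the metric $g_u=e^{2u}g_0$. In particular, for every nonzero $z\in\Lambda_1$ and every constant $c\in\mathbb{R}$, there is no solution $u\in C^\infty(\mathbb{S}^n)$ to the equation $$Q(g_u)=z+c.$$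
   Context: A couple of positive integers $(m,n)$ is called admissible if $n>1$, and $n\ge 2m$ in case $n$ is even. $(\mathbb{S}^n,g_0)$ is the standard round unit $n$-sphere, $d\mu_0$ is its Riemannian (Lebesgue) measure, all functions and vector fields are real and smooth, and $\Delta_0$ is the positive Laplacian of $g_0$. For $u\in C^\infty(\mathbb{S}^n)$ set $g_u=e^{2u}g_0$. $\Lambda_1$ denotes the $(n+1)$-dimensional space of first spherical harmonics on $(\mathbb{S}^n,g_0)$ (the eigenspace of $\Delta_0$ for the eigenvalue $n$, i.e. restrictions to $\mathbb{S}^n$ of linear forms on $\mathbb{R}^{n+1}$). $X\cdot q$ denotes the derivative of the function $q$ along the vector field $X$. A conformal Killing field is a vector field $X$ such that the Lie derivative of $g_0$ along $X$ is a function times $g_0$. Define the Paneitz--Branson operator of $g_0$ by $$P_0=\prod_{k=1}^m\left[\Delta_0+\left(\tfrac n2-k\right)\left(\tfrac n2+k-1\right)\right].$$ Case $n=2m$: $Q_0=Q(g_0)=(2m-1)!$, $\;Q(g_u)=e^{-2mu}(Q_0+P_0[u])$, and the $Q$-curvature increment operator is $\mathbf{Q}[u]=Q(g_u)-Q_0$. Case $n\ne 2m$: $P_u(\cdot)=e^{-(\frac n2+m)u}P_0\left[e^{(\frac n2-m)u}\,\cdot\,\right]$, the $Q$-curvature $Q(g_u)$ is defined by $\left(\frac n2-m\right)Q(g_u)=P_u(1)$, $Q_0=Q(g_0)$, and the (renormalized) $Q$-curvature increment operator is $\mathbf{Q}[u]=\left(\frac n2-m\right)\left[Q(g_u)-Q_0\right]$.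 *)

(* Defs.v *)
From HB Require Import structures.
From mathcomp Require Import all_boot all_order all_algebra.
From mathcomp Require Import all_classical all_reals all_analysis.
From mathcomp Require Import ring.

Set Implicit Arguments.
Unset Strict Implicit.
Unset Printing Implicit Defensive.

Import Order.TTheory GRing.Theory Num.Theory.
Import numFieldNormedType.Exports.

Local Open Scope classical_set_scope.
Local Open Scope ring_scope.

Definition dot (R : realType) (N : nat) (x y : 'rV[R]_N) : R :=
  \sum_(i < N) x 0 i * y 0 i.

Definition basis_vec (R : realType) (N : nat) (i : 'I_N) : 'rV[R]_N :=
  delta_mx 0 i.

(* The library norm on ['rV[R]_N] is the sup norm; it is only used through the
   topology it induces. *)
Fixpoint Ck (R : realType) (N k : nat) (U : set 'rV[R]_N)
    (F : 'rV[R]_N -> R) : Prop :=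
  (forall x, U x -> {for x, continuous F}) /\
  if k is k'.+1 then
    forall i : 'I_N, (forall x, U x -> derivable F x (basis_vec R i)) /\
      Ck k' U (fun x => 'D_(basis_vec R i) F x)
  else True.

Definition Cinfty (R : realType) (N : nat) (U : set 'rV[R]_N)
    (F : 'rV[R]_N -> R) : Prop := forall k, Ck k U F.

(** * The round sphere S^n in R^(n+1) *)

Definition sphere (R : realType) (n : nat) : Type :=
  {x : 'rV[R]_n.+1 | dot x x == 1}.

Lemma basis_vec_on_sphere (R : realType) (n : nat) (i : 'I_n.+1) :
  dot (basis_vec R i) (basis_vec R i) == 1.
Proof.
rewrite /dot (bigD1 i)//= !mxE !eqxx mulr1 big1 ?addr0// => j /negbTE ji.
by rewrite !mxE ji andbF mulr0.
Qed.

Definition pole (R : realType) (n : nat) : sphere R n :=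
  exist _ (basis_vec R ord0) (basis_vec_on_sphere R ord0).

(* [x |-> x / |x|]; the value at 0 is irrelevant. *)
Definition radial (R : realType) (n : nat) (x : 'rV[R]_n.+1) : sphere R n :=
  insubd (pole R n) ((Num.sqrt (dot x x))^-1 *: x).

(* Smoothness on a submanifold: locally the restriction of a smooth function
   of the ambient space. *)
Definition smooth (R : realType) (n : nat) (f : sphere R n -> R) : Prop :=
  forall x : sphere R n, exists (U : set 'rV[R]_n.+1) (F : 'rV[R]_n.+1 -> R),
    [/\ open U, U (val x), Cinfty U F &
        forall y : sphere R n, U (val y) -> f y = F (val y)].

(* For [v] tangent at [x], the differential of [f] at [x] applied to [v]: the
   derivative at [t = 0] of [f] along the curve [t |-> (x + t v) / |x + t v|]
   of the sphere, whose velocity at [t = 0] is [v]. *)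
Definition sdiff (R : realType) (n : nat) (f : sphere R n -> R)
    (x : sphere R n) (v : 'rV[R]_n.+1) : R :=
  'D_v (fun y => f (radial y)) (val x).

(* Vector fields are maps to R^(n+1) with values in the tangent spaces; g_0 is
   the restriction of [dot]. *)
Definition smooth_vf (R : realType) (n : nat)
    (X : sphere R n -> 'rV[R]_n.+1) : Prop :=
  (forall x, dot (X x) (val x) = 0) /\
  (forall i, smooth (fun x => X x 0 i)).

Definition vf_deriv (R : realType) (n : nat) (X : sphere R n -> 'rV[R]_n.+1)
    (f : sphere R n -> R) : sphere R n -> R :=
  fun x => sdiff f x (X x).

Definition vec_diff (R : realType) (n : nat) (X : sphere R n -> 'rV[R]_n.+1)
    (x : sphere R n) (v : 'rV[R]_n.+1) : 'rV[R]_n.+1 :=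
  \row_i sdiff (fun y => X y 0 i) x v.

Definition tan_proj (R : realType) (n : nat) (x : sphere R n)
    (v : 'rV[R]_n.+1) : 'rV[R]_n.+1 :=
  v - dot v (val x) *: val x.

(* Levi-Civita connection of g_0 (the sphere is a submanifold of R^(n+1)). *)
Definition cov_deriv (R : realType) (n : nat) (X : sphere R n -> 'rV[R]_n.+1)
    (x : sphere R n) (v : 'rV[R]_n.+1) : 'rV[R]_n.+1 :=
  tan_proj x (vec_diff X x v).

(* Trace of the endomorphism [v |-> cov_deriv X x v] of the tangent space at
   [x], computed as the trace on R^(n+1) of its composition with [tan_proj x]. *)
Definition sdiv (R : realType) (n : nat) (X : sphere R n -> 'rV[R]_n.+1)
    (x : sphere R n) : R :=
  \sum_(i < n.+1) (cov_deriv X x (tan_proj x (basis_vec R i))) 0 i.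

(* The tangent vector with [dot (sgrad f x) v = sdiff f x v], [v] tangent. *)
Definition sgrad (R : realType) (n : nat) (f : sphere R n -> R)
    (x : sphere R n) : 'rV[R]_n.+1 :=
  \row_i sdiff f x (tan_proj x (basis_vec R i)).

Definition laplacian (R : realType) (n : nat) (f : sphere R n -> R) :
    sphere R n -> R :=
  fun x => - sdiv (sgrad f) x.

Definition Lambda1 (R : realType) (n : nat) (z : sphere R n -> R) : Prop :=
  smooth z /\ forall x, laplacian z x = n%:R * z x.

(* The i-th coordinate of [X, Y] is the derivation [X, Y] applied to the
   coordinate function x_i, i.e. X . Y_i - Y . X_i. *)
Definition lie_bracket (R : realType) (n : nat)
    (X Y : sphere R n -> 'rV[R]_n.+1) : sphere R n -> 'rV[R]_n.+1 :=
  fun x => vec_diff Y x (X x) - vec_diff X x (Y x).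

(* (L_X g_0)(Y, Z) *)
Definition lie_metric (R : realType) (n : nat)
    (X Y Z : sphere R n -> 'rV[R]_n.+1) : sphere R n -> R :=
  fun x => vf_deriv X (fun y => dot (Y y) (Z y)) x
    - dot (lie_bracket X Y x) (Z x) - dot (Y x) (lie_bracket X Z x).

Definition conformal_killing (R : realType) (n : nat)
    (X : sphere R n -> 'rV[R]_n.+1) : Prop :=
  smooth_vf X /\
  exists2 phi : sphere R n -> R, smooth phi &
    forall Y Z, smooth_vf Y -> smooth_vf Z ->
      forall x, lie_metric X Y Z x = phi x * dot (Y x) (Z x).

(** * Lebesgue measure on R^n and Riemannian measure of the sphere *)

Section lebesgue_cons.
Context (R : realType) (n : nat).
Local Notation rT := (measurableTypeR R).
Variable mu : {sigma_finite_measure set (n.-tuple rT) -> \bar R}.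

Definition tcons (p : rT * n.-tuple rT) : n.+1.-tuple rT :=
  [the n.+1.-tuple rT of p.1 :: p.2].

Lemma measurable_tcons : measurable_fun [set: rT * n.-tuple rT] tcons.
Proof. exact: measurable_cons. Qed.

Definition lebesgue_cons : set (n.+1.-tuple rT) -> \bar R :=
  pushforward (@lebesgue_measure R \x mu)%E tcons.

HB.instance Definition _ := Measure.copy lebesgue_cons
  (measure_function_pushforward__canonical__measure_function_Measure
     (@lebesgue_measure R \x mu)%E measurable_tcons).

Lemma lebesgue_cons_sigma_finite : sigma_finite setT lebesgue_cons.
Proof.
have /sigma_finiteP[F [TF ndF Foo]] := sigma_finiteT (@lebesgue_measure R).
have /sigma_finiteP[G [TG ndG Goo]] := sigma_finiteT mu.
pose g (t : n.+1.-tuple rT) : rT * n.-tuple rT :=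
  (tnth t ord0, [tuple of behead t]).
have tK : cancel tcons g.
  by case=> x t; rewrite /g /tcons /=; congr (_, _); apply/val_inj.
have mg : measurable_fun setT g.
  apply: measurable_fun_pair => /=; first exact: measurable_tnth.
  exact: measurable_behead.
exists (fun i => g @^-1` (F i `*` G i)).
  rewrite -preimage_bigcup -[LHS](preimage_setT g); congr (g @^-1` _).
  rewrite -setXTT TF TG; apply/seteqP; split => [[x y]|[x y]].
    move=> [/= [i _ Fx] [j _ Gy]]; exists (maxn i j) => //; split.
      by move: x Fx; exact/subsetPset/ndF/leq_maxl.
    by move: y Gy; exact/subsetPset/ndG/leq_maxr.
  by move=> [i _ []/= ? ?]; split; exists i.
move=> i; have [mF Fi] := Foo i; have [mG Gi] := Goo i; split.
  by rewrite -[X in measurable X]setTI; apply: mg => //; exact: measurableX.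
rewrite /lebesgue_cons /pushforward.
have -> : tcons @^-1` (g @^-1` (F i `*` G i)) = F i `*` G i.
  by rewrite -comp_preimage (_ : g \o tcons = id)//; apply/funext => p; exact: tK.
by rewrite product_measure1E// lte_mul_pinfty// ge0_fin_numE.
Qed.

HB.instance Definition _ := Measure_isSigmaFinite.Build _ _ _
  lebesgue_cons lebesgue_cons_sigma_finite.

End lebesgue_cons.

Fixpoint lebesgue_tuple (R : realType) (n : nat) :
    {sigma_finite_measure set (n.-tuple (measurableTypeR R)) -> \bar R} :=
  if n is n'.+1 then lebesgue_cons (lebesgue_tuple R n')
  else \d_([tuple]).

(* Inverse stereographic projection R^n -> S^n from [pole R n]; it is a chart
   of the sphere minus that point. *)
Definition stereo (R : realType) (n : nat) (y : 'rV[R]_n) : 'rV[R]_n.+1 :=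
  (1 + dot y y)^-1 *: row_mx (dot y y - 1)%:M (2 *: y).

Lemma stereo_on_sphere (R : realType) (n : nat) (y : 'rV[R]_n) :
  dot (stereo y) (stereo y) == 1.
Proof.
have d0 : 0 <= dot y y by rewrite sumr_ge0// => i _; rewrite -expr2 sqr_ge0.
have d1 : 1 + dot y y != 0 by rewrite gt_eqF// ltr_pwDl.
rewrite /stereo; set c := (_)^-1.
have -> : dot (c *: row_mx (dot y y - 1)%:M (2 *: y))
              (c *: row_mx (dot y y - 1)%:M (2 *: y)) =
          c ^+ 2 * ((dot y y - 1) ^+ 2 + 2 ^+ 2 * dot y y).
  rewrite [LHS](@big_split_ord _ _ _ 1 n)/= big_ord1 !mxE.
  rewrite (unsplitK (inl _)) !mxE eqxx mulr1n [in RHS]mulrDr.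
  congr (_ + _); first by ring.
  by rewrite /dot !mulr_sumr; apply: eq_bigr => i _; rewrite !mxE (unsplitK (inr _)) mxE; ring.
by apply/eqP; rewrite /c; field.
Qed.

Definition stereo_chart (R : realType) (n : nat) (y : 'rV[R]_n) : sphere R n :=
  exist _ (stereo y) (stereo_on_sphere y).

(* Matrix of g_0 in this chart. *)
Definition chart_metric (R : realType) (n : nat) (y : 'rV[R]_n) : 'M[R]_n :=
  \matrix_(i, j) dot ('D_(basis_vec R i) (@stereo R n) y)
                     ('D_(basis_vec R j) (@stereo R n) y).

(* Integral against the Riemannian measure [sqrt (det g_0) dy] of g_0; the one
   point outside the chart is a null set. *)
Definition sphere_int (R : realType) (n : nat) (f : sphere R n -> R) : R :=
  \int[lebesgue_tuple R n]_t
    let y := \row_i (tnth t i : R) in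
    f (stereo_chart y) * Num.sqrt (\det (chart_metric y)).

(** * Paneitz-Branson operator and Q-curvature *)

Definition admissible (m n : nat) : Prop :=
  [/\ (0 < m)%N, (1 < n)%N & ~~ odd n -> (m.*2 <= n)%N].

(* The factors are polynomials in [laplacian] and commute, so their order is
   immaterial. *)
Fixpoint paneitz (R : realType) (n m : nat) (f : sphere R n -> R) :
    sphere R n -> R :=
  if m is k.+1 then
    let h := paneitz k f in
    fun x => laplacian h x
      + (n%:R / 2 - m%:R) * (n%:R / 2 + m%:R - 1) * h x
  else f.

(* P_u; used when [n != 2m]. *)
Definition paneitz_conf (R : realType) (n m : nat) (u h : sphere R n -> R) :
    sphere R n -> R :=
  fun x => expR (- (n%:R / 2 + m%:R) * u x)
    * paneitz m (fun y => expR ((n%:R / 2 - m%:R) * u y) * h y) x.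

(* [Qcurv m u] is Q(g_u) for g_u = e^(2u) g_0; Q_0 = (2m-1)! if [n = 2m]. *)
Definition Qcurv (R : realType) (n m : nat) (u : sphere R n -> R) :
    sphere R n -> R :=
  fun x =>
    if n == m.*2 then
      expR (- (m.*2)%:R * u x) * (((m.*2).-1)`!%:R + paneitz m u x)
    else paneitz_conf m u (fun=> 1) x / (n%:R / 2 - m%:R).

Definition Q0 (R : realType) (n m : nat) : sphere R n -> R :=
  if n == m.*2 then fun=> ((m.*2).-1)`!%:R else Qcurv m (fun=> 0).

Definition Qincr (R : realType) (n m : nat) (u : sphere R n -> R) :
    sphere R n -> R :=
  fun x =>
    if n == m.*2 then Qcurv m u x - Q0 m x
    else (n%:R / 2 - m%:R) * (Qcurv m u x - Q0 m x).

Definition Qgraph (R : realType) (n m : nat) :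
    set ((sphere R n -> R) * (sphere R n -> R)) :=
  [set (u, Qincr m u) | u in @smooth R n].

(* Main.v *)
From HB Require Import structures.
Require Import Defs.
From mathcomp Require Import all_boot all_order all_algebra.
From mathcomp Require Import all_classical all_reals all_analysis.
From mathcomp Require Import measurable_realfun.
From mathcomp Require Import ring lra zify.

(** The integral identity expresses the invariance, under the conformal group,
    of the functional whose gradient is the Q-curvature. For a conformal
    Killing field [X] with factor [2 * s], the Paneitz-Branson operator [P] of
    order [2 * m] intertwines the infinitesimal actions
    [w |-> X w + a * s * w] and [w |-> X w + b * s * w], where [a = n / 2 - m]
    and [b = n / 2 + m]. Since [a + b = n], integration by parts makes these
    two actions opposite adjoints of each other; as [P] is symmetric, the
    integral of [(X w + a * s * w) * P w] vanishes for each [w]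
    ([int_covariant]). For [w] the exponential of [a * u] this is, after one
    more integration by parts, a nonzero multiple of the integral of [X Q]
    against the measure of [g_u] ([int_Q_noncritical]); if [n = 2 * m], take
    [w = u], the constant curvature [(n - 1)!] being accounted for by the
    value of [P] on the first harmonic [s] ([int_Q_critical]).

    The covariance ([pan_covariant]) is proved by induction on [m] from two
    facts: the commutator of the Laplacian with [X] ([lapl_act]), and the
    formula [pan_factor] for [P] applied to [s * f], which holds because [s]
    is a first harmonic ([conformal_lapl_factor]) whose gradient is again
    conformal, with factor [- 2 * s] ([eigen_conformal]). The latter is a
    Bochner type argument: the first derivatives of the 1-homogeneous
    extension of [s] are harmonic, so constant.

    All of this is algebra over the ring of smooth functions with the
    derivations [D_i f], the components in R^(n+1) of the gradient, for which
    [D_i x_j = delta_ij - x_i x_j], [sum_i x_i D_i f = 0] and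
    [D_i D_j - D_j D_i = x_i D_j - x_j D_i]. They avoid charts and local
    frames: the Laplacian is minus the sum of the [D_i D_i], and the conformal
    Killing equation is a system of equations on the coordinates of [X]. The
    relations are read off an extension of [f] to a neighbourhood of a point
    in R^(n+1); the third one is the symmetry of its second derivatives.

    Two analytic facts about the integral are needed. A nonnegative smooth
    function with zero integral vanishes ([sphere_int_sq]). And the integral
    of [D_k f] is that of [n * x_k * f] ([sphere_int_tder]), the divergence
    theorem for the projections of the basis vectors: in the stereographic
    chart the divergence is a sum of partial derivatives of functions that
    tend to zero along lines, and by Fubini each of them integrates to zero.

    For the second claim, apply the identity to the conformal field [X], the
    gradient of [z]: the integral of the squared gradient of [z] against the
    measure of [g_u] vanishes, so [z] is constant, and a constant
    eigenfunction for the eigenvalue [n] is zero. *)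

Set Implicit Arguments.
Unset Strict Implicit.
Unset Printing Implicit Defensive.

Import Order.TTheory GRing.Theory Num.Theory.
Import numFieldNormedType.Exports.

Local Open Scope classical_set_scope.
Local Open Scope ring_scope.

(** * Directional derivatives and C^1 functions on R^N *)

Lemma sum_delta (A : pzRingType) (I : finType) (j : I) (F : I -> A) :
  \sum_i (i == j)%:R * F i = F j.
Proof.
by rewrite (bigD1 j)//= eqxx mul1r big1 ?addr0// => i /negbTE ->; exact: mul0r.
Qed.

Section euclidean_calculus.
Context (R : realType) (N : nat).
Implicit Types (F : 'rV[R]_N -> R) (x v : 'rV[R]_N) (U : set 'rV[R]_N).

Lemma rV_norm_le v (c : R) : 0 <= c -> (forall j, `|v 0 j| <= c) -> `|v| <= c.
Proof.
move=> c0 vc; rewrite [X in X <= _]mx_normrE; apply: bigmax_le => // -[i j] _ /=.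
by rewrite (ord1 i).
Qed.

Lemma coord_norm_le v j : `|v 0 j| <= `|v|.
Proof.
rewrite [X in _ <= X]mx_normrE.
exact: (le_bigmax _ (fun ij : 'I_1 * 'I_N => `|v ij.1 ij.2|) (0, j)).
Qed.

Lemma is_derive_line (W : normedModType R) (F : 'rV[R]_N -> W) x v (t : R) (d : W) :
  is_derive (x + t *: v) v F d <->
  is_derive t 1 (fun s : R => F (x + s *: v)) d.
Proof.
have E : (fun h : R => h^-1 *: ((F \o shift (x + t *: v)) (h *: v)
          - F (x + t *: v))) =
         (fun h : R => h^-1 *: (((fun s : R => F (x + s *: v)) \o shift t)
          (h *: 1) - F (x + t *: v))).
  apply/funext => h /=; congr (_ *: (F _ - _)).
  by rewrite scaler1 scalerDl addrCA.
by split=> -[d1 d2]; split; move: d1 d2; rewrite /derivable /derive ?E.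
Qed.

Lemma mean_value_line F x v (s : R) :
  (forall t : R, 0 <= t <= 1 -> derivable F (x + (t * s) *: v) v) ->
  exists2 t : R, 0 <= t <= 1 &
    F (x + s *: v) - F x = s * 'D_v F (x + (t * s) *: v).
Proof.
move=> dF.
have D (t : R) : 0 <= t <= 1 -> is_derive t 1 (fun t : R => F (x + (t * s) *: v))
    ('D_v F (x + (t * s) *: v) * s).
  move=> t01.
  apply: (@is_derive1_comp _ (fun t => F (x + t *: v)) (fun t => t * s)).
    by apply/is_derive_line/derivableP; exact: dF.
  by apply: is_derive_eq; rewrite scaler0 add0r scaler1.
have := @MVT_segment R (fun t => F (x + (t * s) *: v))
  (fun t => 'D_v F (x + (t * s) *: v) * s) 0 1 ler01.
case.
- by move=> t; rewrite in_itv/= => /andP[t0 t1]; apply: D; rewrite !ltW.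
- apply: derivable_within_continuous => t; rewrite in_itv/= => t01.
  by have [] := D _ t01.
- move=> c; rewrite in_itv/= => c01.
  by rewrite mul1r mul0r scale0r addr0 subr0 mulr1 mulrC => ->; exists c.
Qed.

Definition dotr (g : 'rV[R]_N) (h : 'rV[R]_N) : R := dot h g.

Lemma dotr_linear g : linear (dotr g).
Proof.
move=> a u v; rewrite /dotr /dot scaler_sumr -big_split/=.
by apply: eq_bigr => i _; rewrite !mxE mulrDl -mulrA.
Qed.
HB.instance Definition _ g := GRing.isLinear.Build _ _ _ _ _ (dotr_linear g).

Lemma continuous_dotr g : continuous (dotr g).
Proof.
rewrite (_ : dotr g = \sum_(i < N) (fun h : 'rV[R]_N => h 0 i * g 0 i)).
  elim/big_ind : _ => [|f1 f2 c1 c2|i _] x.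
  - exact: cst_continuous.
  - by apply: continuousD; [exact: c1|exact: c2].
  - by apply: continuousM; [exact: coord_continuous|exact: cst_continuous].
by apply/funext => h; rewrite fct_sumE.
Qed.

(** The first [k] steps of the walk from 0 to [h] along the coordinate axes. *)
Definition trunc (k : nat) (h : 'rV[R]_N) : 'rV[R]_N :=
  \row_i (if (i < k)%N then h 0 i else 0).

Lemma truncS (k : 'I_N) h : trunc k.+1 h = trunc k h + h 0 k *: basis_vec R k.
Proof.
apply/rowP => i; rewrite !mxE eqxx/= ltnS leq_eqVlt.
have [->|ik] := eqVneq i k; first by rewrite eqxx ltnn/= mulr1 add0r.
by rewrite (inj_eq val_inj) (negbTE ik)/= mulr0 addr0.
Qed.

Lemma grad_sum F x v : differentiable F x ->
  'D_v F x = \sum_(i < N) v 0 i * 'D_(basis_vec R i) F x.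
Proof.
move=> dF; rewrite deriveE// {1}(row_sum_delta v) linear_sum/=.
by apply: eq_bigr => i _; rewrite linearZ/= deriveE.
Qed.

(** Moving from [x] to [x + h] one coordinate at a time, the mean value theorem
    applies on each of the [N] segments, and continuity of the partial
    derivatives makes each error small compared with the norm of [h]. *)
Lemma C1_differentiable U F x : open U -> U x -> Ck 1 U F ->
  differentiable F x.
Proof.
move=> oU Ux [_ CF].
pose g := \row_i 'D_(basis_vec R i) F x : 'rV[R]_N.
have E (e : R) : 0 < e -> exists2 d : R, 0 < d & forall h : 'rV[R]_N,
    `|h| < d -> `|F (h + x) - (F x + dotr g h)| <= e * `|h|.
  move=> e0.
  have e'0 : 0 < e / N.+1%:R by rewrite divr_gt0.
  have : \forall y \near x, U y /\ forall i : 'I_N,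
      `|'D_(basis_vec R i) F x - 'D_(basis_vec R i) F y| <= e / N.+1%:R.
    apply: filterI; first exact: open_nbhs_nbhs.
    apply (@filter_forall _ 'I_N (fun i => [set y |
      `|'D_(basis_vec R i) F x - 'D_(basis_vec R i) F y| <= e / N.+1%:R])
      (nbhs x) _) => i.
    have [_ [CDi _]] := CF i.
    have /cvgr_dist_le := CDi _ Ux; exact.
  move=> /nbhs_normP[d /= d0 xd].
  exists d => // h hd.
  have seg (k : 'I_N) (t : R) : 0 <= t <= 1 ->
      U (x + trunc k h + (t * h 0 k) *: basis_vec R k) /\
      `|'D_(basis_vec R k) F x -
        'D_(basis_vec R k) F (x + trunc k h + (t * h 0 k) *: basis_vec R k)|
         <= e / N.+1%:R.
    move=> /andP[t0 t1].
    have : ball_ Num.norm x d (x + trunc k h + (t * h 0 k) *: basis_vec R k).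
      rewrite /ball_/= -addrA opprD addNKr normrN (le_lt_trans _ hd)//.
      apply: rV_norm_le => // j; rewrite !mxE eqxx/=.
      have [->|jk] := eqVneq j k.
        rewrite ltnn add0r mulr1 normrM ger0_norm// (le_trans _ (coord_norm_le h k))//.
        by rewrite ler_piMl.
      by rewrite mulr0 addr0; case: ifP => _; rewrite ?normr0// coord_norm_le.
    by move=> /xd[].
  have step (k : 'I_N) :
      `|F (x + trunc k.+1 h) - F (x + trunc k h) - h 0 k * g 0 k|
        <= e / N.+1%:R * `|h|.
    have [t t01] : exists2 t : R, 0 <= t <= 1 &
        F (x + trunc k h + h 0 k *: basis_vec R k) - F (x + trunc k h) =
        h 0 k * 'D_(basis_vec R k) F
          (x + trunc k h + (t * h 0 k) *: basis_vec R k).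
      by apply: (@mean_value_line F) => t /(seg k)[/(proj1 (CF k))].
    rewrite truncS addrA => ->; rewrite mxE -mulrBr normrM distrC mulrC.
    rewrite ler_pM// ?coord_norm_le//.
    by have [_] := seg k _ t01.
  have -> : F (h + x) - (F x + dotr g h) =
      \sum_(k < N) (F (x + trunc k.+1 h) - F (x + trunc k h) - h 0 k * g 0 k).
    rewrite sumrB /dotr /dot opprD addrA; congr (_ - _).
    rewrite -(big_mkord xpredT (fun k => F (x + trunc k.+1 h) - F (x + trunc k h))).
    rewrite telescope_sumr//; congr (F _ - F _).
      by rewrite addrC; congr (_ + _); apply/rowP => i; rewrite mxE ltn_ord.
    by rewrite -[LHS]addr0; congr (_ + _); apply/rowP => i; rewrite !mxE.
  apply: (le_trans (ler_norm_sum _ _ _)).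
  apply: (le_trans (ler_sum _ (fun k _ => step k))).
  rewrite sumr_const card_ord -[X in X <= _]mulr_natl mulrA ler_wpM2r//.
  by rewrite mulrCA ler_piMr ?(ltW e0)// ler_pdivrMr// mul1r ler_nat.
have o0 : F \o shift x = cst (F x) + dotr g +o_ (0 : 'rV[R]_N) id.
  apply/eqaddoP => e /E[d d0 H].
  have near0 : \forall h \near (0 : 'rV[R]_N), `|h| < d.
    by apply/nbhs_normP; exists d => //= h; rewrite /ball_/= sub0r normrN.
  by apply: filterS near0 => h; exact: H.
have dE : 'd F x = dotr g :> ('rV[R]_N -> R).
  by apply: diff_unique => //; exact: continuous_dotr.
apply/diff_locallyP; rewrite dE; split => //; exact: continuous_dotr.
Unshelve. all: by end_near. Qed.

Lemma is_derive_shift F x v w (d : R) :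
  is_derive (x + w) v F d -> is_derive x v (fun y => F (y + w)) d.
Proof.
have E : (fun h : R => h^-1 *: ((F \o shift (x + w)) (h *: v) - F (x + w))) =
  (fun h : R => h^-1 *: (((fun y => F (y + w)) \o shift x) (h *: v) - F (x + w))).
  by apply/funext => h /=; rewrite addrA.
by move=> [d1 d2]; split; move: d1 d2; rewrite /derivable /derive E.
Qed.

Lemma basis_vec_norm_le (i : 'I_N) (c : R) : `|c *: basis_vec R i| <= `|c|.
Proof.
apply: rV_norm_le => // j; rewrite !mxE eqxx/=; case: eqP => _.
  by rewrite mulr1.
by rewrite mulr0 normr0.
Qed.

Lemma second_difference F x (a b : 'rV[R]_N) (s : R) :
  (forall t t' : R, 0 <= t <= 1 -> 0 <= t' <= 1 ->
     derivable F (x + (t * s) *: a + (t' * s) *: b) a /\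
     derivable ('D_a F) (x + (t * s) *: a + (t' * s) *: b) b) ->
  exists t t' : R, [/\ 0 <= t <= 1, 0 <= t' <= 1 &
    F (x + s *: a + s *: b) - F (x + s *: a) - (F (x + s *: b) - F x) =
    s * (s * 'D_b ('D_a F) (x + (t * s) *: a + (t' * s) *: b))].
Proof.
move=> dF.
have i0 : 0 <= (0 : R) <= 1 by rewrite lexx ler01.
have i1 : 0 <= (1 : R) <= 1 by rewrite lexx ler01.
pose G y := F (y + s *: b) - F y.
have dG (t : R) : 0 <= t <= 1 -> is_derive (x + (t * s) *: a) a G
   ('D_a F (x + (t * s) *: a + s *: b) - 'D_a F (x + (t * s) *: a)).
  move=> t01; have [d1 _] := dF t 1 t01 i1; have [d0 _] := dF t 0 t01 i0.
  rewrite mul1r in d1; rewrite mul0r scale0r addr0 in d0.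
  have := is_derive_shift (derivableP d1).
  move=> D1; have D0 := derivableP d0.
  exact: is_deriveB.
have [t t01] : exists2 t : R, 0 <= t <= 1 &
    G (x + s *: a) - G x = s * 'D_a G (x + (t * s) *: a).
  by apply: (@mean_value_line G) => t /dG[].
have [_ ->] := dG t t01.
have [t' t'01 ->] : exists2 t' : R, 0 <= t' <= 1 &
   'D_a F (x + (t * s) *: a + s *: b) - 'D_a F (x + (t * s) *: a) =
    s * 'D_b ('D_a F) (x + (t * s) *: a + (t' * s) *: b).
  by apply: (@mean_value_line ('D_a F)) => t' /(dF t t' t01)[].
by move=> GE; exists t, t'; split; [exact: t01|exact: t'01|exact: GE].
Qed.

(** Both iterated partial derivatives are limits of the same second difference
    quotient. *)
Lemma derive_comm U F x i j : open U -> U x -> Ck 2 U F ->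
  'D_(basis_vec R i) ('D_(basis_vec R j) F) x =
  'D_(basis_vec R j) ('D_(basis_vec R i) F) x.
Proof.
move=> oU Ux CF; set a := basis_vec R j; set b := basis_vec R i.
have cont k l : {for x, continuous ('D_(basis_vec R k) ('D_(basis_vec R l) F))}.
  by have [_ /(_ l)[_ [_ /(_ k)[_ [+ _]]]]] := CF; exact.
have der k y : U y -> derivable F y (basis_vec R k).
  by have [_ /(_ k)[+ _]] := CF; exact.
have der2 k l y : U y -> derivable ('D_(basis_vec R l) F) y (basis_vec R k).
  by have [_ /(_ l)[_ [_ /(_ k)[+ _]]]] := CF; exact.
apply/eqP; rewrite -subr_eq0 -normr_le0; apply/ler_addgt0Pr => e e0.
rewrite add0r.
have e20 : 0 < e / 2 by rewrite divr_gt0.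
have : \forall y \near x, U y /\ (`|'D_b ('D_a F) x - 'D_b ('D_a F) y| <= e / 2 /\
   `|'D_a ('D_b F) x - 'D_a ('D_b F) y| <= e / 2).
  apply: filterI; first exact: open_nbhs_nbhs.
  apply: filterI.
    by have /cvgr_dist_le := cont i j; exact.
  by have /cvgr_dist_le := cont j i; exact.
move=> /nbhs_normP[d /= d0 xd].
have [s [s0 ssd]] : exists s : R, 0 < s /\ s + s < d.
  by exists (d / 3); split; lra.
have s0' := ltW s0.
have near_x k l (t t' : R) : 0 <= t <= 1 -> 0 <= t' <= 1 ->
    ball_ Num.norm x d (x + (t * s) *: basis_vec R k + (t' * s) *: basis_vec R l).
  move=> /andP[t0 t1] /andP[t'0 t'1].
  rewrite /ball_/= -addrA opprD addNKr normrN.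
  apply: (le_lt_trans (ler_normD _ _)).
  apply: le_lt_trans ssd.
  apply: lerD; apply: (le_trans (basis_vec_norm_le _ _));
  by rewrite ger0_norm ?mulr_ge0// ler_piMl.
have [t [t' [t01 t'01 E1]]] : exists t t' : R, [/\ 0 <= t <= 1, 0 <= t' <= 1 &
    F (x + s *: a + s *: b) - F (x + s *: a) - (F (x + s *: b) - F x) =
    s * (s * 'D_b ('D_a F) (x + (t * s) *: a + (t' * s) *: b))].
  apply: second_difference => t t' t01 t'01.
  by have [Uy _] := xd _ (near_x j i t t' t01 t'01); split; [exact: der|exact: der2].
have [r [r' [r01 r'01 E2]]] : exists t t' : R, [/\ 0 <= t <= 1, 0 <= t' <= 1 &
    F (x + s *: b + s *: a) - F (x + s *: b) - (F (x + s *: a) - F x) =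
    s * (s * 'D_a ('D_b F) (x + (t * s) *: b + (t' * s) *: a))].
  apply: second_difference => r r' r01 r'01.
  by have [Uy _] := xd _ (near_x i j r r' r01 r'01); split; [exact: der|exact: der2].
have [_ [+ _]] := xd _ (near_x j i t t' t01 t'01).
have [_ [_ +]] := xd _ (near_x i j r r' r01 r'01).
move: E1 E2; rewrite (addrAC x (s *: b)) -/a -/b.
move: ('D_b ('D_a F) (x + (t * s) *: a + (t' * s) *: b))
  ('D_a ('D_b F) (x + (r * s) *: b + (r' * s) *: a)) => p q.
move: ('D_b ('D_a F) x) ('D_a ('D_b F) x) => p0 q0 E1 E2.
have /(mulfI (lt0r_neq0 s0))/(mulfI (lt0r_neq0 s0)) -> : s * (s * p) = s * (s * q).
  have sub4 (A B C D : R) : A - B - (C - D) = A - C - (B - D) by ring.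
  by rewrite -E1 -E2; exact: sub4.
move=> H1 H2; apply: (le_trans (ler_distD q _ _)).
by rewrite [X in _ + X]distrC (splitr e) addrC lerD.
Qed.

(** * Stability of C^k functions *)

Lemma Ck_subset k U V F : V `<=` U -> Ck k U F -> Ck k V F.
Proof.
move=> VU; elim: k F => [|k IHk] F [cF dF]; first by split => // y /VU; exact: cF.
split=> [y /VU|i]; first exact: cF.
by have [di /IHk Ci] := dF i; split => // y /VU; exact: di.
Qed.

Lemma Ck_pred k U F : Ck k.+1 U F -> Ck k U F.
Proof.
elim: k F => [|k IHk] F [cF dF]; first by split.
by split => // i; have [di /IHk Ci] := dF i; split.
Qed.

Lemma near_eq_continuous F G y : (\near y, F y = G y) ->
  {for y, continuous F} -> {for y, continuous G}.
Proof.
move=> FG cF; rewrite /prop_for /continuous_at -(nbhs_singleton FG).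
exact: (cvg_trans (near_eq_cvg FG) cF).
Qed.

Lemma Ck_eq k U F G : open U -> (forall y, U y -> F y = G y) ->
  Ck k U F -> Ck k U G.
Proof.
move=> oU FG CF.
have near_eq F' G' y : (forall z, U z -> F' z = G' z) -> U y ->
    \near y, F' y = G' y.
  move=> FG' Uy; have nU : nbhs y U := open_nbhs_nbhs (conj oU Uy).
  exact: filterS nU.
elim: k F G FG CF => [|k IHk] F G FG [cF dF]; split=> //.
- by move=> y Uy; exact: near_eq_continuous (near_eq _ _ _ FG Uy) (cF y Uy).
- by move=> y Uy; exact: near_eq_continuous (near_eq _ _ _ FG Uy) (cF y Uy).
move=> i; have [di Ci] := dF i; split=> [y Uy|].
  by have := near_eq_is_derive (near_eq _ _ _ FG Uy) (derivableP (di y Uy)); case.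
by apply: IHk Ci => y Uy; apply: near_eq_derive; exact: near_eq.
Qed.

Lemma Ck_cst k U (c : R) : Ck k U (fun=> c).
Proof.
elim: k c => [|k IHk] c; (split; first by move=> y _; exact: cst_continuous) => //.
move=> i.
split=> [y _|]; first exact: derivable_cst.
have -> : 'D_(basis_vec R i) (fun=> c) = (fun=> 0) :> ('rV[R]_N -> R).
  by apply/funext => y; have [_] := is_derive_cst c y (basis_vec R i).
exact: IHk.
Qed.

Lemma CkD k U F G : open U -> Ck k U F -> Ck k U G ->
  Ck k U (fun y => F y + G y).
Proof.
move=> oU; elim: k F G => [|k IHk] F G [cF dF] [cG dG].
  by split=> // y Uy; apply: continuousD; [exact: cF|exact: cG].
split=> [y Uy|i]; first by apply: continuousD; [exact: cF|exact: cG].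
have [di Ci] := dF i; have [di' Ci'] := dG i; split=> [y Uy|].
  by apply: derivableD; [exact: di|exact: di'].
apply: (Ck_eq oU _ (IHk _ _ Ci Ci')) => y Uy.
by rewrite -deriveD; [|exact: di|exact: di'].
Qed.

Lemma Ck_sum k U (I : Type) (r : seq I) (F : I -> 'rV[R]_N -> R) : open U ->
  (forall i, Ck k U (F i)) -> Ck k U (fun y => \sum_(i <- r) F i y).
Proof.
move=> oU CF; elim: r => [|i r IHr].
  by apply: (Ck_eq oU _ (Ck_cst k U 0)) => y _; rewrite big_nil.
by apply: (Ck_eq oU _ (CkD oU (CF i) IHr)) => y _; rewrite big_cons.
Qed.

Lemma CkM k U F G : open U -> Ck k U F -> Ck k U G ->
  Ck k U (fun y => F y * G y).
Proof.
move=> oU; elim: k F G => [|k IHk] F G.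
  move=> [cF dF] [cG dG].
  by split=> // y Uy; apply: continuousM; [exact: cF|exact: cG].
move=> CF CG; have [cF dF] := CF; have [cG dG] := CG.
split=> [y Uy|i]; first by apply: continuousM; [exact: cF|exact: cG].
have [di Ci] := dF i; have [di' Ci'] := dG i; split=> [y Uy|].
  by apply: derivableM; [exact: di|exact: di'].
apply: (Ck_eq oU _ (CkD oU (IHk _ _ (Ck_pred CF) Ci') (IHk _ _ (Ck_pred CG) Ci))).
by move=> y Uy; rewrite deriveM; [|exact: di|exact: di'].
Qed.

Lemma is_derive_coord (j : 'I_N) x v : is_derive x v (fun y : 'rV[R]_N => y 0 j) (v 0 j).
Proof.
rewrite -(addr0 x) -(scale0r v); apply/is_derive_line.
rewrite (_ : (fun s : R => _) = (fun s : R => x 0 j + s * v 0 j)); last first.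
  by apply/funext => s; rewrite !mxE.
by apply: is_derive_eq; rewrite /GRing.scale/=; ring.
Qed.

Lemma Ck_coord k U (j : 'I_N) : Ck k U (fun y => y 0 j).
Proof.
case: k => [|k]; (split; first by move=> y _; exact: coord_continuous) => //.
move=> i.
split=> [y _|]; first by have [] := is_derive_coord j y (basis_vec R i).
have -> : 'D_(basis_vec R i) (fun y : 'rV[R]_N => y 0 j) = (fun=> basis_vec R i 0 j).
  by apply/funext => y; have [_] := is_derive_coord j y (basis_vec R i).
exact: Ck_cst.
Qed.

Lemma is_derive_expR_comp F x v (d : R) : is_derive x v F d ->
  is_derive x v (fun y => expR (F y)) (expR (F x) * d).
Proof.
move=> dF; rewrite -(addr0 x) -(scale0r v); apply/is_derive_line.
apply: (@is_derive1_comp _ expR (fun s => F (x + s *: v))) => //.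
by apply/is_derive_line; rewrite scale0r addr0.
Qed.

Lemma Ck_expR k U F : open U -> Ck k U F -> Ck k U (fun y => expR (F y)).
Proof.
move=> oU; elim: k F => [|k IHk] F.
  by move=> [cF _]; split=> // y Uy; apply: continuous_comp; [exact: cF|exact: continuous_expR].
move=> CF; have [cF dF] := CF; split=> [y Uy|i].
  by apply: continuous_comp; [exact: cF|exact: continuous_expR].
have [di Ci] := dF i.
have D y : U y -> is_derive y (basis_vec R i) (fun y => expR (F y))
    (expR (F y) * 'D_(basis_vec R i) F y).
  by move=> Uy; apply: is_derive_expR_comp; apply: derivableP; exact: di.
split=> [y /D[]//|].
apply: (Ck_eq oU _ (CkM oU (IHk _ (Ck_pred CF)) Ci)) => y Uy.
by have [_ ->] := D y Uy.
Qed.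

Lemma is_derive_row (c : R -> 'rV[R]_N) (t : R) (dc : 'I_N -> R) :
  (forall k, is_derive t 1 (fun s => c s 0 k) (dc k)) ->
  is_derive t 1 c (\row_k dc k).
Proof.
move=> dC.
have dck k : differentiable (fun s : R => c s 0 k) t.
  by apply/derivable1_diffP; have [] := dC k.
have cE : c = \sum_(k < N) (fun s : R => c s 0 k *: basis_vec R k).
  by apply/funext => s; rewrite fct_sumE -row_sum_delta.
have -> : \row_k dc k = \sum_(k < N) dc k *: basis_vec R k.
  by rewrite [LHS]row_sum_delta; apply: eq_bigr => k _; rewrite mxE.
rewrite [in X in is_derive _ _ X]cE; apply: is_derive_sum => k; split.
  by apply/derivable1_diffP; exact: differentiableZl.
rewrite deriveE; last exact: differentiableZl.
by rewrite diffZl// -deriveE//; have [_ ->] := dC k.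
Qed.

Lemma is_derive_curve F (c : R -> 'rV[R]_N) (t : R) (dc : 'I_N -> R) :
  differentiable F (c t) ->
  (forall k, is_derive t 1 (fun s => c s 0 k) (dc k)) ->
  is_derive t 1 (fun s => F (c s))
    (\sum_k dc k * 'D_(basis_vec R k) F (c t)).
Proof.
move=> dF /is_derive_row dcv.
have dct : differentiable c t by apply/derivable1_diffP; have [] := dcv.
split; first by apply/derivable1_diffP; exact: differentiable_comp.
rewrite deriveE; last exact: differentiable_comp.
rewrite diff_comp//= -[in LHS](@deriveE _ _ _ c)//; have [_ ->] := dcv.
rewrite -deriveE// grad_sum//.
by apply: eq_bigr => k _; rewrite mxE.
Qed.

Lemma continuous_row (T : topologicalType) (c : T -> 'rV[R]_N) :
  (forall k, continuous (fun t => c t 0 k)) -> continuous c.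
Proof.
move=> cc; rewrite (_ : c = fun t => \sum_(k < N) c t 0 k *: basis_vec R k); last first.
  by apply/funext => t; rewrite -row_sum_delta.
by apply: continuous_big => [|k _]; [exact: add_continuous|]; move=> t; apply: continuousZl; exact: cc.
Qed.

End euclidean_calculus.

(** * Tangential derivatives of smooth functions on the sphere *)

Section tangential_derivatives.
Context (R : realType) (n : nat).
Implicit Types (f g : sphere R n -> R) (x : sphere R n) (v : 'rV[R]_n.+1).
Implicit Types (U : set 'rV[R]_n.+1) (F : 'rV[R]_n.+1 -> R).

Lemma dot_sphere x : dot (val x) (val x) = 1.
Proof. by apply/eqP; exact: (valP x). Qed.

Lemma val_radial (y : 'rV[R]_n.+1) : 0 < dot y y ->
  val (radial y) = (Num.sqrt (dot y y))^-1 *: y.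
Proof.
move=> y0; rewrite /radial insubdK// -topredE/=.
set c := (Num.sqrt _)^-1.
have -> : dot (c *: y) (c *: y) = c ^+ 2 * dot y y.
  by rewrite /dot mulr_sumr; apply: eq_bigr => i _; rewrite !mxE; ring.
by rewrite /c exprVn sqr_sqrtr ?(ltW y0)// mulVf// gt_eqF.
Qed.

Lemma radial_sphere x : radial (val x) = x.
Proof.
by apply/val_inj; rewrite val_radial dot_sphere// sqrtr1 invr1 scale1r.
Qed.

Definition extension f x U F := [/\ open U, U (val x), Cinfty U F &
  forall y : sphere R n, U (val y) -> f y = F (val y)].

Lemma is_derive_extension f U F (c : R -> sphere R n) (t : R)
    (dc : 'I_n.+1 -> R) : extension f (c t) U F ->
  (forall k, is_derive t 1 (fun s => val (c s) 0 k) (dc k)) ->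
  is_derive t 1 (fun s => f (c s))
    (\sum_k dc k * 'D_(basis_vec R k) F (val (c t))).
Proof.
move=> [oU Ux CF fF] dC.
have dF := C1_differentiable oU Ux (CF 1%N).
have cc : {for t, continuous (fun s => val (c s))}.
  rewrite (_ : (fun s => val (c s)) =
      \sum_(k < n.+1) (fun s : R => val (c s) 0 k *: basis_vec R k)); last first.
    by apply/funext => s; rewrite fct_sumE -row_sum_delta.
  apply: differentiable_continuous; apply: differentiable_sum => k.
  by apply: differentiableZl; apply/derivable1_diffP; have [] := dC k.
have dFc := is_derive_curve dF dC.
apply: near_eq_is_derive dFc; near=> s; rewrite fF//.
by near: s; apply: cc; exact: open_nbhs_nbhs.
Unshelve. all: by end_near. Qed.

Lemma is_derive_radial x v k :
  is_derive (0 : R) 1 (fun s : R => val (radial (val x + s *: v)) 0 k)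
    (tan_proj x v 0 k).
Proof.
pose p s := dot (val x + s *: v) (val x + s *: v).
have pE : p = fun s : R => 1 + s * (2 * dot v (val x)) + s * (s * dot v v).
  apply/funext => s; transitivity (dot (val x) (val x)
    + s * (2 * dot v (val x)) + s * (s * dot v v)); last by rewrite dot_sphere.
  rewrite /p /dot !mulr_sumr -!big_split/=.
  by apply: eq_bigr => i _; rewrite !mxE; ring.
have p0 : p 0 = 1 by rewrite pE; ring.
have dp : is_derive (0 : R) 1 p (2 * dot v (val x)).
  by rewrite pE; apply: is_derive_eq; rewrite /GRing.scale/=; ring.
have dq : is_derive (0 : R) 1 (fun s : R => (Num.sqrt (p s))^-1 * (val x + s *: v) 0 k)
    (tan_proj x v 0 k).
  have p01 : 0 < p 0 by rewrite p0.
  have ds : is_derive (0 : R) 1 (fun s : R => Num.sqrt (p s)) (dot v (val x)).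
    have := @is_derive1_comp _ _ p 0 _ _ (is_derive1_sqrt p01) dp.
    by rewrite p0 sqrtr1 mulr1 mulKf.
  have s0 : Num.sqrt (p 0) != 0 by rewrite p0 sqrtr1.
  have dx : is_derive (0 : R) 1 (fun s : R => (val x + s *: v) 0 k) (v 0 k).
    rewrite (_ : (fun s : R => _) = (fun s : R => val x 0 k + s * v 0 k)).
      by apply: is_derive_eq; rewrite /GRing.scale/=; ring.
    by apply/funext => s; rewrite !mxE.
  have := is_deriveM (@is_deriveV _ (fun s => Num.sqrt (p s)) 0 _ 1 s0 ds) dx.
  move=> /is_derive_eq; apply.
  rewrite p0 sqrtr1 scale0r addr0 /tan_proj !mxE /GRing.scale/= invr1 expr1n invr1; ring.
apply: near_eq_is_derive dq.
have cp : p @ (0 : R) --> p 0.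
  by apply: differentiable_continuous; apply/derivable1_diffP; have [] := dp.
have p01 : 0 < p 0 by rewrite p0.
near=> s; rewrite val_radial ?mxE//.
near: s; exact: (cvgr_gt (p 0)).
Unshelve. all: by end_near. Qed.

Lemma sdiff_extension f x v U F : extension f x U F ->
  sdiff f x v = \sum_k tan_proj x v 0 k * 'D_(basis_vec R k) F (val x).
Proof.
move=> eF.
have := @is_derive_extension f U F (fun s => radial (val x + s *: v)) 0
  (fun k => tan_proj x v 0 k).
rewrite scale0r addr0 radial_sphere => /(_ eF (fun k => is_derive_radial x v k)).
move=> /(@is_derive_line _ _ _ (fun y => f (radial y)) (val x) v 0 _).
rewrite scale0r addr0 => D.
by rewrite /sdiff; have [_ ->] := D.
Qed.

Lemma tan_proj_basis x k l :
  tan_proj x (basis_vec R k) 0 l = (k == l)%:R - val x 0 k * val x 0 l.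
Proof.
rewrite !mxE eqxx/= eq_sym; congr (_ - _ * _).
rewrite /dot (bigD1 k)//= big1 ?addr0 ?mxE ?eqxx ?mul1r// => j jk.
by rewrite mxE (negbTE jk) mul0r.
Qed.

Lemma tan_proj_tangent x v : dot v (val x) = 0 -> tan_proj x v = v.
Proof. by rewrite /tan_proj => ->; rewrite scale0r subr0. Qed.

(** The components in R^(n+1) of the gradient.  Unlike the partial derivatives
    in a chart, these derivations are defined on the whole sphere. *)
Definition tder k f : sphere R n -> R := fun x => sdiff f x (tan_proj x (basis_vec R k)).

Lemma tder_extension f x k U F : extension f x U F ->
  tder k f x = 'D_(basis_vec R k) F (val x)
    - val x 0 k * \sum_l val x 0 l * 'D_(basis_vec R l) F (val x).
Proof.
move=> eF; rewrite /tder (sdiff_extension _ eF) tan_proj_tangent; last first.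
  rewrite /dot; under eq_bigr do rewrite tan_proj_basis.
  under eq_bigr do rewrite mulrBl -mulrA.
  rewrite sumrB -mulr_sumr -/(dot (val x) (val x)) dot_sphere mulr1.
  by rewrite (bigD1 k)//= big1 ?eqxx ?mul1r ?addr0 ?subrr// => j /negbTE jk; rewrite eq_sym jk mul0r.
under eq_bigr do rewrite tan_proj_basis mulrBl -mulrA.
rewrite sumrB -mulr_sumr; congr (_ - _).
by rewrite (bigD1 k)//= big1 ?eqxx ?mul1r ?addr0// => j /negbTE jk; rewrite eq_sym jk mul0r.
Qed.

(** In [tder_extension] the radial correction of each partial derivative is a
    multiple of the position, which is orthogonal to the velocity of the curve. *)
Lemma is_derive_smooth_curve f (c : R -> sphere R n) (t : R) (dc : 'I_n.+1 -> R) :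
  smooth f -> (forall k, is_derive t 1 (fun s => val (c s) 0 k) (dc k)) ->
  is_derive t 1 (fun s => f (c s)) (\sum_k dc k * tder k f (c t)).
Proof.
move=> /(_ (c t))[U [F eF]] dC.
have /is_derive_eq := is_derive_extension eF dC; apply.
(* differentiate [dot (c s) (c s) = 1] *)
have tang : \sum_k dc k * val (c t) 0 k = 0.
  have D : is_derive t 1 (\sum_k (fun s => val (c s) 0 k * val (c s) 0 k))
      (\sum_k (val (c t) 0 k *: dc k + val (c t) 0 k *: dc k)).
    by apply: is_derive_sum => k; exact: is_deriveM.
  have one : \sum_k (fun s => val (c s) 0 k * val (c s) 0 k) = (fun=> 1 : R).
    by apply/funext => s; rewrite fct_sumE; exact: (dot_sphere (c s)).
  rewrite one in D; case: D => _; have [_ ->] := is_derive_cst (1 : R) t (1 : R).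
  move=> /esym/eqP; rewrite big_split/= -mulr2n.
  rewrite mulrn_eq0/= => /eqP sum0; rewrite -[RHS]sum0.
  by apply: eq_bigr => k _; rewrite /GRing.scale/= mulrC.
under [RHS]eq_bigr do rewrite (tder_extension _ eF) mulrBr mulrA.
by rewrite sumrB -mulr_suml tang mul0r subr0.
Qed.

Lemma smoothD f g : smooth f -> smooth g -> smooth (fun x => f x + g x).
Proof.
move=> sf sg x; have [U [F [oU Ux CF fF]]] := sf x.
have [V [G [oV Vx CG gG]]] := sg x; have oUV := openI oU oV.
exists (U `&` V), (fun y => F y + G y); split => //.
  by move=> k; apply: CkD => //; apply: Ck_subset; [|exact: CF| |exact: CG]; move=> y [].
by move=> y [Uy Vy]; rewrite fF// gG.
Qed.

Lemma smoothM f g : smooth f -> smooth g -> smooth (fun x => f x * g x).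
Proof.
move=> sf sg x; have [U [F [oU Ux CF fF]]] := sf x.
have [V [G [oV Vx CG gG]]] := sg x; have oUV := openI oU oV.
exists (U `&` V), (fun y => F y * G y); split => //.
  by move=> k; apply: CkM => //; apply: Ck_subset; [|exact: CF| |exact: CG]; move=> y [].
by move=> y [Uy Vy]; rewrite fF// gG.
Qed.

Lemma smooth_cst (c : R) : smooth (fun _ : sphere R n => c).
Proof.
by move=> x; exists setT, (fun=> c); split => //; [exact: openT|move=> k; exact: Ck_cst].
Qed.

Lemma smooth_coord k : smooth (fun x : sphere R n => val x 0 k).
Proof.
move=> x; exists setT, (fun y => y 0 k); split => //; first exact: openT.
by move=> l; exact: Ck_coord.
Qed.

Lemma smooth_expR f : smooth f -> smooth (fun x => expR (f x)).
Proof.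
move=> sf x; have [U [F [oU Ux CF fF]]] := sf x.
exists U, (fun y => expR (F y)); split => //; first by move=> k; exact: Ck_expR.
by move=> y Uy; rewrite fF.
Qed.

(** The right-hand side of [tder_extension] makes sense and is smooth near [x]
    in the ambient space; so [tder] preserves smoothness, and iterated tangential
    derivatives are computed from those of one ambient extension. *)
Lemma extension_tder f x k U F : extension f x U F ->
  extension (tder k f) x U (fun y => 'D_(basis_vec R k) F y
    + -1 * (y 0 k * \sum_l y 0 l * 'D_(basis_vec R l) F y)).
Proof.
move=> [oU Ux CF fF]; split => //; last first.
  by move=> y Uy; rewrite (@tder_extension f y k U F)// mulN1r.
have CDF l m : Ck m U ('D_(basis_vec R l) F).
  by have [_ /(_ l)[]] := CF m.+1.
move=> m; apply: CkD => //; apply: CkM => //; first exact: Ck_cst.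
apply: CkM => //; first exact: Ck_coord.
by apply: Ck_sum => // l; apply: CkM => //; exact: Ck_coord.
Qed.

Lemma smooth_tder k f : smooth f -> smooth (tder k f).
Proof.
by move=> sf x; have [U [F eF]] := sf x; exists U; eexists; exact: extension_tder eF.
Qed.

End tangential_derivatives.

Section tangential_rules.
Context (R : realType) (n : nat).
Implicit Types (f g : sphere R n -> R) (x : sphere R n).

Lemma is_derive_radial_smooth f x v : smooth f ->
  is_derive (val x) v (fun y => f (radial y)) (sdiff f x v).
Proof.
move=> /(_ x)[U [F eF]]; rewrite (sdiff_extension _ eF).
have := @is_derive_extension _ _ f U F (fun s => radial (val x + s *: v)) 0
  (fun k => tan_proj x v 0 k).
rewrite scale0r addr0 radial_sphere => /(_ eF (fun k => is_derive_radial x v k)).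
move=> /(@is_derive_line _ _ _ (fun y => f (radial y)) (val x) v 0 _).
by rewrite scale0r addr0.
Qed.

Lemma sdiff_tder f x v : smooth f -> dot v (val x) = 0 ->
  sdiff f x v = \sum_k v 0 k * tder k f x.
Proof.
move=> /(_ x)[U [F eF]] vx; rewrite (sdiff_extension _ eF) tan_proj_tangent//.
under [RHS]eq_bigr do rewrite (tder_extension _ eF) mulrBr mulrA.
by rewrite sumrB -mulr_suml -/(dot v (val x)) vx mul0r subr0.
Qed.

Lemma tderD k f g x : smooth f -> smooth g ->
  tder k (fun y => f y + g y) x = tder k f x + tder k g x.
Proof.
move=> sf sg; set v := tan_proj x (basis_vec R k).
have := is_deriveD (is_derive_radial_smooth x v sf) (is_derive_radial_smooth x v sg).
by case.
Qed.

Lemma tderM k f g x : smooth f -> smooth g ->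
  tder k (fun y => f y * g y) x = f x * tder k g x + g x * tder k f x.
Proof.
move=> sf sg; set v := tan_proj x (basis_vec R k).
have := is_deriveM (is_derive_radial_smooth x v sf) (is_derive_radial_smooth x v sg).
by case=> _; rewrite !radial_sphere.
Qed.

Lemma tder_cst k (c : R) x : tder k (fun=> c) x = 0.
Proof. by rewrite /tder /sdiff; have [_] := is_derive_cst c (val x) (tan_proj x (basis_vec R k)). Qed.

Lemma tder_expR k f x : smooth f ->
  tder k (fun y => expR (f y)) x = expR (f x) * tder k f x.
Proof.
move=> sf; set v := tan_proj x (basis_vec R k).
have := is_derive_expR_comp (is_derive_radial_smooth x v sf).
by case=> _; rewrite radial_sphere.
Qed.

Lemma tder_coord i j x :
  tder i (fun y => val y 0 j) x = (i == j)%:R - val x 0 i * val x 0 j.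
Proof.
have eF : extension (fun y : sphere R n => val y 0 j) x setT (fun y => y 0 j).
  by split => //; [exact: openT|move=> l; exact: Ck_coord].
rewrite /tder (sdiff_extension _ eF) tan_proj_tangent.
  have dc k : 'D_(basis_vec R k) (fun y : 'rV[R]_n.+1 => y 0 j) (val x) = (k == j)%:R.
    by have [_ ->] := is_derive_coord j (val x) (basis_vec R k); rewrite mxE eqxx/= eq_sym.
  under eq_bigr do rewrite dc.
  rewrite (bigD1 j)//= eqxx mulr1 big1 ?addr0 ?tan_proj_basis// => k /negbTE ->.
  by rewrite mulr0.
rewrite /dot; under eq_bigr do rewrite tan_proj_basis mulrBl -mulrA.
rewrite sumrB -mulr_sumr -/(dot (val x) (val x)) dot_sphere mulr1.
rewrite (bigD1 i)//= eqxx mul1r big1 ?addr0 ?subrr// => k /negbTE ki.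
by rewrite eq_sym ki mul0r.
Qed.

Lemma coord_tder f x : smooth f -> \sum_i val x 0 i * tder i f x = 0.
Proof.
move=> /(_ x)[U [F eF]].
under eq_bigr do rewrite (tder_extension _ eF) mulrBr mulrA.
by rewrite sumrB -mulr_suml -/(dot (val x) (val x)) dot_sphere mul1r subrr.
Qed.

(** The fields projecting the basis vectors do not commute; the symmetry of the
    second derivatives of an ambient extension leaves only the terms coming from
    the radial correction. *)
Lemma tder_comm i j f x : smooth f ->
  tder i (tder j f) x = tder j (tder i f) x
    + val x 0 i * tder j f x - val x 0 j * tder i f x.
Proof.
move=> /(_ x)[U [F eF]]; have [oU Ux CF _] := eF.
pose d (k : 'I_n.+1) (G : 'rV[R]_n.+1 -> R) : R := 'D_(basis_vec R k) G (val x).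
pose dd k l : R := d k ('D_(basis_vec R l) F).
have ddC k l : dd k l = dd l k by exact: derive_comm oU Ux (CF 2%N).
have dD k l : is_derive (val x) (basis_vec R k) ('D_(basis_vec R l) F) (dd k l).
  by apply: derivableP; have [_ /(_ l)[_ [_ /(_ k)[+ _]]]] := CF 2%N; exact.
have dX k l : is_derive (val x) (basis_vec R k) (fun y : 'rV[R]_n.+1 => y 0 l) ((k == l)%:R : R).
  have := is_derive_coord l (val x) (basis_vec R k).
  by rewrite mxE eqxx/= eq_sym.
pose E := \sum_l val x 0 l * d l F.
pose S k := \sum_l val x 0 l * dd k l.
have dE k : is_derive (val x) (basis_vec R k)
    (fun y => \sum_l y 0 l * 'D_(basis_vec R l) F y) (S k + d k F).
  pose h l (y : 'rV[R]_n.+1) : R := y 0 l * 'D_(basis_vec R l) F y.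
  rewrite (_ : (fun y => _) = \sum_l h l); last first.
    by apply/funext => y; rewrite fct_sumE.
  have := is_derive_sum (fun l => is_deriveM (dX k l) (dD k l)).
  move=> /is_derive_eq; apply.
  rewrite big_split/=; congr (_ + _).
  rewrite (bigD1 k)//= eqxx big1 ?addr0 => [|l /negbTE lk].
    by rewrite /GRing.scale/= mulr1.
  by rewrite eq_sym lk scaler0.
have dFj j' k : d k (fun y => 'D_(basis_vec R j') F y
    + -1 * (y 0 j' * \sum_l y 0 l * 'D_(basis_vec R l) F y)) =
    dd k j' - (k == j')%:R * E - val x 0 j' * (S k + d k F).
  have := is_deriveD (dD k j') (is_deriveM (is_derive_cst (-1 : R) (val x) (basis_vec R k))
     (is_deriveM (dX k j') (dE k))).
  case=> _ D; rewrite [LHS]D scaler0 addr0 /GRing.scale/= -[\sum_(l < _) _]/E.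
  by rewrite -/(d k F); ring.
have sum_delta j' : \sum_l val x 0 l * (l == j')%:R = val x 0 j'.
  by rewrite (bigD1 j')//= eqxx mulr1 big1 ?addr0// => l /negbTE ->; exact: mulr0.
have T i' j' : tder i' (tder j' f) x = dd i' j' - (i' == j')%:R * E
    - val x 0 j' * (S i' + d i' F)
    - val x 0 i' * (S j' - val x 0 j' * E
        - val x 0 j' * (\sum_l val x 0 l * S l + E)).
  rewrite (tder_extension _ (extension_tder j' eF)) [X in X - _]dFj.
  congr (_ - _ * _).
  under eq_bigr do rewrite [X in _ * X]dFj.
  rewrite (eq_bigr (fun l => val x 0 l * dd j' l - (val x 0 l * (l == j')%:R) * E
     - val x 0 j' * (val x 0 l * S l) - val x 0 j' * (val x 0 l * d l F))); last first.
    by move=> l _; rewrite (ddC l); ring.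
  rewrite !sumrB -!mulr_sumr -mulr_suml.
  by rewrite sum_delta /S /E; ring.
rewrite !T !(tder_extension _ eF) (ddC j i) (eq_sym j i) -/E -/(d i F) -/(d j F).
move: (\sum_(l < _) _) (E) (S i) (S j) (d i F) (d j F) (dd i j) => A e si sj di dj dij.
by move: ((i == j)%:R : R) (val x 0 i : R) (val x 0 j : R) => *; ring.
Qed.

End tangential_rules.

(** * The ring of smooth functions *)

Section sfun.
Context (R : realType) (n : nat).

Definition smooth_pred : {pred (sphere R n -> R)} := fun f => `[< smooth f >].

Lemma smooth_subring : subring_closed smooth_pred.
Proof.
split.
- by apply/asboolP; exact: smooth_cst.
- move=> f g /asboolP sf /asboolP sg; apply/asboolP.
  rewrite (_ : f - g = (fun x => f x + (fun y => -1 * g y) x)); last first.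
    by apply/funext => x; rewrite mulN1r.
  by apply: smoothD => //; apply: smoothM => //; exact: smooth_cst.
- by move=> f g /asboolP sf /asboolP sg; apply/asboolP; exact: smoothM.
Qed.

HB.instance Definition _ := GRing.isSubringClosed.Build _ smooth_pred smooth_subring.

Record sfun := Sfun { sfun_val :> sphere R n -> R; _ : sfun_val \in smooth_pred }.

HB.instance Definition _ := [isSub for sfun_val].
HB.instance Definition _ := [Equality of sfun by <:].
HB.instance Definition _ := [Choice of sfun by <:].
HB.instance Definition _ := GRing.SubChoice_isSubComPzRing.Build _ smooth_pred sfun (subringClosedP _).

Implicit Types (f g : sfun) (i j : 'I_n.+1).

Lemma sfunP f : smooth f.
Proof. by case: f => f sf; apply/asboolP; exact: sf. Qed.

Lemma sfun_ext f g : (forall x, f x = g x) -> f = g.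
Proof. by move=> fg; apply/val_inj/funext. Qed.

Definition sfun_of (f : sphere R n -> R) (sf : smooth f) : sfun := Sfun (asboolT sf).

Definition sfun_cst (c : R) : sfun := sfun_of (smooth_cst c).
Definition sfun_x i : sfun := sfun_of (smooth_coord i).
Definition sfun_exp f : sfun := sfun_of (smooth_expR (sfunP f)).
Definition sfun_der i f : sfun := sfun_of (smooth_tder i (sfunP f)).

Lemma sfun_derD i f g : sfun_der i (f + g) = sfun_der i f + sfun_der i g.
Proof. by apply: sfun_ext => x; exact: tderD (sfunP f) (sfunP g). Qed.

Lemma sfun_derM i f g : sfun_der i (f * g) = f * sfun_der i g + g * sfun_der i f.
Proof. by apply: sfun_ext => x; exact: tderM (sfunP f) (sfunP g). Qed.

Lemma sfun_der_cst i c : sfun_der i (sfun_cst c) = 0.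
Proof. by apply: sfun_ext => x; exact: tder_cst. Qed.

Lemma sfun_der_exp i f : sfun_der i (sfun_exp f) = sfun_exp f * sfun_der i f.
Proof. by apply: sfun_ext => x; exact: tder_expR (sfunP f). Qed.

Lemma sfun_der_x i j : sfun_der i (sfun_x j) = (i == j)%:R - sfun_x i * sfun_x j.
Proof.
apply: sfun_ext => x; rewrite [LHS]tder_coord.
by case: (i == j).
Qed.

Lemma sum_sfunE (I : Type) (r : seq I) (F : I -> sfun) x :
  (\sum_(i <- r) F i) x = \sum_(i <- r) F i x.
Proof. by elim: r => [|i r IHr]; rewrite ?big_nil// !big_cons -IHr. Qed.

Lemma sfun_sum_xD f : \sum_i sfun_x i * sfun_der i f = 0.
Proof.
by apply: sfun_ext => x; rewrite sum_sfunE; exact: coord_tder (sfunP f).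
Qed.

Lemma sfun_sum_xx : \sum_i sfun_x i * sfun_x i = 1.
Proof. by apply: sfun_ext => x; rewrite sum_sfunE; exact: dot_sphere. Qed.

Lemma sfun_der_comm i j f :
  sfun_der i (sfun_der j f) = sfun_der j (sfun_der i f)
    + sfun_x i * sfun_der j f - sfun_x j * sfun_der i f.
Proof. by apply: sfun_ext => x; exact: tder_comm (sfunP f). Qed.

Lemma sfun_cstD a b : sfun_cst (a + b) = sfun_cst a + sfun_cst b.
Proof. exact: sfun_ext. Qed.

Lemma sfun_cstM a b : sfun_cst (a * b) = sfun_cst a * sfun_cst b.
Proof. exact: sfun_ext. Qed.

Lemma sfun_expD f g : sfun_exp (f + g) = sfun_exp f * sfun_exp g.
Proof. by apply: sfun_ext => x; exact: expRD. Qed.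

End sfun.

(** * Lebesgue integration on R^n *)

Section lebesgue_tuple.
Context (R : realType).
Local Notation rT := (measurableTypeR R).
Local Notation lam := (@lebesgue_measure R).

Definition row_of n (t : n.-tuple rT) : 'rV[R]_n := \row_i (tnth t i : R).

(** An open set is a countable union of cubes with rational centres. *)
Lemma measurable_row_open n (U : set 'rV[R]_n) : open U ->
  measurable [set t : n.-tuple rT | U (row_of t)].
Proof.
move=> oU.
pose B (p : 'rV[rat]_n * nat) : set (n.-tuple rT) :=
  \bigcap_(i in [set: 'I_n])
     [set t : n.-tuple rT | `|ratr (p.1 0 i) - tnth t i| < p.2.+1%:R^-1].
have mB p : measurable (B p).
  apply: fin_bigcap_measurable => // i _.
  have -> : [set t : n.-tuple rT | `|ratr (p.1 0 i) - tnth t i| < p.2.+1%:R^-1] =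
      setT `&` ((fun t : n.-tuple rT => tnth t i) @^-1`
        (ball (ratr (p.1 0 i) : R) p.2.+1%:R^-1)).
    by rewrite setTI; apply/seteqP; split => t.
  by apply: measurable_tnth => //; apply: open_measurable; exact: ball_open.
pose J (p : 'rV[rat]_n * nat) := forall t, B p t -> U (row_of t).
have -> : [set t : n.-tuple rT | U (row_of t)] =
    \bigcup_p (if pselect (J p) then B p else set0).
  apply/seteqP; split => [t Ut|t [p _]]; last first.
    by case: pselect => [Jp /= Bt|//]; exact: Jp.
  have /nbhs_ballP[e /= e0 eU] := open_nbhs_nbhs (conj oU Ut).
  have [k ke] : exists k : nat, (k.+1%:R^-1 : R) < e / 2.
    have e20 : 0 < e / 2 by rewrite divr_gt0.
    have [k _ /(_ k (leqnn k)) ke] := near_infty_natSinv_lt (PosNum e20).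
    by exists k.
  have qP (i : 'I_n) : exists q : rat, `|ratr q - tnth t i| < k.+1%:R^-1.
    have k0 : 0 < k.+1%:R^-1 :> R by rewrite invr_gt0.
    have tk : (tnth t i : R) < tnth t i + k.+1%:R^-1 by rewrite ltrDl.
    have [q] := rat_in_itvoo tk.
    rewrite in_itv/= => /andP[q1 q2]; exists q.
    by rewrite ger0_norm ?subr_ge0 ?ltW// ltrBlDl.
  have [q qP'] := choice qP.
  exists (\row_i q i, k) => //; case: pselect => [_ i _ /=|]; first by rewrite mxE.
  case=> t' Bt'; apply: eU => /=; rewrite mx_norm_ball /ball_/=.
  apply: (@le_lt_trans _ _ (k.+1%:R^-1 + k.+1%:R^-1)); last by rewrite (splitr e) ltrD.
  apply: rV_norm_le => [|i]; first by rewrite addr_ge0.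
  rewrite !mxE (le_trans (ler_distD (ratr (q i)) _ _))//.
  rewrite distrC lerD// ltW//.
  by have := Bt' i I; rewrite /= mxE.
apply: countable_bigcupT_measurable => [|p]; first exact: countableP.
by case: pselect => ?; [exact: mB|exact: measurable0].
Qed.

Lemma measurable_row_fun n (g : 'rV[R]_n -> R) : continuous g ->
  measurable_fun [set: n.-tuple rT] (fun t => g (row_of t)).
Proof.
move=> cg; apply: (measurability _ (RGenOpens.measurableE R)) => _ [_ [a [b ->] <-]].
rewrite setTI; apply: (@measurable_row_open _ (g @^-1` `]a, b[)).
by apply: open_comp => [y _|]; [exact: cg|exact: interval_open].
Qed.

Local Notation mu := (lebesgue_tuple R).

Definition uncons n (t : n.+1.-tuple rT) : rT * n.-tuple rT :=
  (tnth t ord0, [tuple of behead t]).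

Lemma measurable_uncons n : measurable_fun setT (@uncons n).
Proof.
apply: measurable_fun_pair => /=; first exact: measurable_tnth.
exact: measurable_behead.
Qed.

Lemma unconsK n : cancel (@uncons n) (@tcons R n).
Proof. by move=> t; apply: val_inj => /=; rewrite [in RHS](tuple_eta t). Qed.

Lemma integrable_cons n (g : n.+1.-tuple rT -> \bar R) :
  (mu n.+1).-integrable setT g <->
  (lam \x mu n)%E.-integrable setT (g \o @tcons R n).
Proof.
have mt := @measurable_tcons R n.
have E : measurable_fun setT g -> (\int[mu n.+1]_t `|g t| =
    \int[lam \x mu n]_p `|(g \o @tcons R n) p|)%E.
  move=> mg; rewrite [LHS](ge0_integral_pushforward mt)//.
  exact: measurableT_comp.
split=> /integrableP[mg goo]; apply/integrableP.
  have mg' : measurable_fun setT (g \o @tcons R n) by exact: measurableT_comp.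
  by rewrite -E.
have mg' : measurable_fun setT g.
  rewrite (_ : g = (g \o @tcons R n) \o @uncons n).
    by apply: measurableT_comp => //; exact: measurable_uncons.
  by apply/funext => t /=; rewrite unconsK.
by rewrite E.
Qed.

Lemma integral_cons n (g : n.+1.-tuple rT -> \bar R) :
  (mu n.+1).-integrable setT g ->
  (\int[mu n.+1]_t g t = \int[lam \x mu n]_p g (tcons p))%E.
Proof.
move=> ig; have [mg _] := integrableP _ _ _ ig.
rewrite [LHS](integral_pushforward (@measurable_tcons R n))//.
exact/integrable_cons.
Qed.

Lemma tnth_tcons0 n a (t : n.-tuple rT) : tnth (tcons (a, t)) ord0 = a.
Proof. by rewrite (tnth_nth a). Qed.

Lemma tnth_tconsS n a (t : n.-tuple rT) j :
  tnth (tcons (a, t)) (lift ord0 j) = tnth t j.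
Proof. by rewrite !(tnth_nth a). Qed.

Lemma integrable_prod (h : R -> R) n : (forall a, 0 <= h a) ->
  lam.-integrable setT (EFin \o h) ->
  (mu n).-integrable setT (fun t => (\prod_(i < n) h (tnth t i))%:E).
Proof.
move=> h0 ih; have [mh hoo] := integrableP _ _ _ ih.
have mhR : measurable_fun setT h by exact/measurable_EFinP.
elim: n => [|n IHn].
  rewrite (_ : (fun t => _) = EFin \o (fun=> 1 : R)); last first.
    by apply/funext => t /=; rewrite big_ord0.
  apply/integrableP; split; first exact/measurable_EFinP/measurable_cst.
  by rewrite integral_dirac//= diracT mul1e normr1 ltry.
have [mP Poo] := integrableP _ _ _ IHn.
have mPR : measurable_fun setT (fun t : n.-tuple rT => \prod_(i < n) h (tnth t i)).
  exact/measurable_EFinP.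
apply/integrable_cons.
have E (p : rT * n.-tuple rT) : ((fun t : n.+1.-tuple rT => (\prod_(i < n.+1) h (tnth t i))%:E) \o @tcons R n) p
    = (h p.1 * \prod_(i < n) h (tnth p.2 i))%:E.
  rewrite /= big_ord_recl; congr (_ * _)%:E.
  by apply: eq_bigr => i _; rewrite tnth_tconsS.
rewrite (funext E).
have m2 : measurable_fun setT
    (fun p : rT * n.-tuple rT => (h p.1 * \prod_(i < n) h (tnth p.2 i))%:E).
  apply/measurable_EFinP; apply: measurable_funM.
    by apply: measurableT_comp => //; exact: measurable_fst.
  by apply: (measurableT_comp mPR); exact: measurable_snd.
apply/integrable12ltyP => //=.
pose C := (\int[mu n]_t `|(\prod_(i < n) h (tnth t i))%:E|)%E.
have C0 : (0 <= C)%E by exact: integral_ge0.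
rewrite (_ : (fun a : rT => _) = (fun a => C * `|(h a)%:E|)%E); last first.
  apply/funext => a; rewrite muleC -ge0_integralZl//; last exact: measurableT_comp.
  by apply: eq_integral => t _ /=; rewrite normrM EFinM.
rewrite ge0_integralZl//; last exact: measurableT_comp.
by apply: lte_mul_pinfty => //; rewrite ge0_fin_numE.
Qed.

(** ** Integrals vanishing on lines *)

Definition upd n (t : n.-tuple rT) (i : 'I_n) (a : R) : n.-tuple rT :=
  [tuple (if j == i then a else tnth t j) | j < n].

(** By Fubini, the [i]-th coordinate can be integrated out first. *)
Lemma integral_lines0 n (g : n.-tuple rT -> R) (i : 'I_n) :
  (mu n).-integrable setT (EFin \o g) ->
  (forall t, \int[lam]_a (g (upd t i a))%:E = 0)%E ->
  (\int[mu n]_t (g t)%:E = 0)%E.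
Proof.
elim: n g i => [g []//|n IHn] g i ig g0.
rewrite integral_cons//; have ig' := (integrable_cons _).1 ig.
have updS (i' : 'I_n) (t : n.-tuple rT) a b :
    upd (tcons (a, t)) (lift ord0 i') b = tcons (a, upd t i' b).
  apply: eq_from_tnth => j; rewrite tnth_mktuple.
  have [j' ->|->] := unliftP ord0 j; last by rewrite !tnth_tcons0.
  by rewrite (inj_eq lift_inj) !tnth_tconsS tnth_mktuple.
have [i'|] := unliftP ord0 i.
  move=> Ei; rewrite -integral12_prod_meas1//.
  have := ae_integrable1 ig' => aeI.
  transitivity (\int[lam]_a (0 : \bar R))%E; last by rewrite integral0.
  apply: ae_eq_integral => //; first exact: (measurable_fubini_F ig').
  case: aeI => N [mN N0 sN]; exists N; split => // a /= nz; apply: sN => /= ia.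
  apply: nz => _.
  apply: (IHn (fun t => g (tcons (a, t))) i') => // t.
  rewrite -[RHS](g0 (tcons (a, t))) Ei; apply: eq_integral => b _.
  by rewrite updS.
move=> Ei; rewrite -integral21_prod_meas1//.
rewrite -[RHS](integral0 (mu n) setT); apply: eq_integral => t _.
rewrite -[RHS](g0 (tcons (0, t))) Ei; apply: eq_integral => a _ /=.
congr (g _)%:E; apply: eq_from_tnth => j; rewrite tnth_mktuple.
have [j' ->|->] := unliftP ord0 j; last by rewrite eqxx tnth_tcons0.
by rewrite !tnth_tconsS.
Qed.

Lemma integral_derive0 (v V : R -> R) : (forall a : R, is_derive a 1 V (v a)) ->
  continuous v -> lam.-integrable setT (EFin \o v) ->
  V k.+1%:R @[k --> \oo] --> 0 -> V (- k.+1%:R) @[k --> \oo] --> 0 ->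
  (\int[lam]_a (v a)%:E = 0)%E.
Proof.
move=> dV cv iv V0 VN0.
pose f_ k := (EFin \o v) \_ `[- k.+1%:R, k.+1%:R].
have [mv _] := integrableP _ _ _ iv.
have [||//|||_ _] := @dominated_convergence _ _ _ lam setT measurableT f_ (EFin \o v)
  (abse \o (EFin \o v)).
- by move=> k; apply/measurable_restrict => //; exact: measurable_funTS.
- exact: mv.
- apply: aeW => a _; apply: cvg_near_cst.
  near=> k; rewrite /f_ patchE ifT// inE/= in_itv/= -ler_norml.
  by rewrite (@le_trans _ _ k%:R) ?ler_nat//; near: k; exact: nbhs_infty_ger.
- exact: integrable_abse.
- apply: aeW => a k _; rewrite /f_ patchE; case: ifP => _ //=.
  by rewrite normr0 lee_fin.
move=> lim.
have limE : (\int[lam]_a f_ k a)%E @[k --> \oo] --> 0%E.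
  rewrite (_ : (fun k => _) = (fun k => (V k.+1%:R - V (- k.+1%:R))%:E)); last first.
    apply/funext => k; rewrite /f_ -integral_mkcond/=.
    rewrite (continuous_FTC2 (F := V)) ?EFinB//.
    - by rewrite gtrN.
    - exact: continuous_subspaceT.
    - split.
      + by move=> a _; have [] := dV a.
      + apply: cvg_at_right_filter; apply: differentiable_continuous.
        by apply/derivable1_diffP; have [] := dV (- k.+1%:R).
      + apply: cvg_at_left_filter; apply: differentiable_continuous.
        by apply/derivable1_diffP; have [] := dV k.+1%:R.
    - by move=> a _; rewrite derive1E; have [_ ->] := dV a.
  apply: cvg_EFin; first by near=> k.
  rewrite -[X in _ --> X]subr0; exact: cvgB.
exact: cvg_unique lim limE.
Unshelve. all: by end_near. Qed.

(** ** A weight with finite integral *)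

(** Decay of order 3/2 is what the n-fold product can afford: on the sphere the
    integrands below decay like the power [1 - 2 * n] of the norm, and
    [3 / 2 * n <= 2 * n - 1] for [n >= 2]. *)
Definition weight (a : R) : R := ((1 + `|a|) * Num.sqrt (1 + `|a|))^-1.

Lemma weight_gt0 a : 0 < weight a.
Proof. by rewrite invr_gt0 mulr_gt0 ?sqrtr_gt0// ltr_pwDl. Qed.

Lemma continuous_weight : continuous weight.
Proof.
move=> a.
have c1 : {for a, continuous (fun a : R => 1 + `|a|)}.
  by apply: continuousD; [exact: cst_continuous|exact: norm_continuous].
have c2 : {for a, continuous (fun a : R => (1 + `|a|) * Num.sqrt (1 + `|a|))}.
  by apply: continuousM => //; apply: continuous_comp => //; exact: sqrt_continuous.
by apply: (cvgV _ c2); rewrite gt_eqF// mulr_gt0 ?sqrtr_gt0// ltr_pwDl.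
Qed.

Lemma integrable_weight : lam.-integrable setT (EFin \o weight).
Proof.
apply/integrableP; split.
  by apply/measurable_EFinP; apply: continuous_measurable_fun; exact: continuous_weight.
under eq_integral => a _ do rewrite /= ger0_norm ?(ltW (weight_gt0 _))//.
rewrite ge0_symfun_integralT; last first.
- by move=> a; rewrite /weight /= normrN.
- exact: continuous_weight.
- by move=> a; rewrite ltW// weight_gt0.
pose F (a : R) : R := - 2 * (Num.sqrt (1 + a))^-1.
have dF (a : R) : -1 < a -> is_derive a 1 F ((1 + a) * Num.sqrt (1 + a))^-1.
  move=> a1; have a10 : 0 < 1 + a by lra.
  have s0 : Num.sqrt (1 + a) != 0 by rewrite gt_eqF// sqrtr_gt0.
  have d1 : is_derive a 1 (fun a : R => 1 + a) (1 : R).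
    by have /is_derive_eq := is_deriveD (is_derive_cst (1 : R) a 1) (is_derive_id a 1); apply; rewrite add0r.
  have ds := @is_derive1_comp _ Num.sqrt (fun a => 1 + a) a _ _ (is_derive1_sqrt a10) d1.
  have := is_deriveM (is_derive_cst (- 2 : R) a 1)
    (@is_deriveV _ (fun a => Num.sqrt (1 + a)) a _ 1 s0 ds).
  move=> /is_derive_eq; apply; rewrite scaler0 addr0 /GRing.scale/=.
  have -> : 1 + a = Num.sqrt (1 + a) ^+ 2 by rewrite sqr_sqrtr// ltW.
  rewrite sqrtr_sqr ger0_norm ?sqrtr_ge0//; field; exact: s0.
have -> : (\int[lam]_(a in [set a | (0 <= a)%R]) (weight a)%:E =
    \int[lam]_(a in `[0%R, +oo[) (weight a)%:E)%E.
  by congr integral; apply/seteqP; split => a /=; rewrite in_itv/= andbT.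
rewrite (@ge0_continuous_FTC2y _ weight F 0 0).
- by rewrite -EFinB -EFinM ltry.
- by move=> a _; rewrite ltW// weight_gt0.
- by apply: continuous_subspaceT; exact: continuous_weight.
- apply/cvgrPdist_le => /= e e0; near=> a.
  have a0 : 0 <= a by near: a; exact: nbhs_pinfty_ge.
  have sa : 2 / e <= Num.sqrt (1 + a).
    rewrite (le_trans (ler_norm _))// -sqrtr_sqr ler_wsqrtr//.
    have : (2 / e) ^+ 2 <= a by near: a; apply: nbhs_pinfty_ge; rewrite num_real.
    lra.
  have s0 : 0 < Num.sqrt (1 + a) by rewrite sqrtr_gt0; lra.
  rewrite sub0r normrN /F normrM normrN !ger0_norm ?invr_ge0 ?(ltW s0)//.
  by rewrite ler_pdivrMr// mulrC -ler_pdivrMr.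
- by move=> a a0; have [] := dF a (lt_trans (ltrN10 R) a0).
- apply: cvg_at_right_filter; apply: differentiable_continuous.
  by apply/derivable1_diffP; have [] := dF 0 (ltrN10 R).
- move=> a; rewrite in_itv/= andbT => a0; rewrite derive1E.
  by have [_ ->] := dF a (lt_trans (ltrN10 R) a0); rewrite /weight ger0_norm// ltW.
Unshelve. all: by end_near. Qed.

(** ** Positivity *)

Definition cube n (c : 'rV[R]_n) (e : R) : set (n.-tuple rT) :=
  [set t | forall i, `|c 0 i - tnth t i| < e].

Lemma measurable_cube n (c : 'rV[R]_n) (e : R) : 0 < e -> measurable (cube c e).
Proof.
move=> e0; have oB : open (ball c e) by exact: ball_open.
have := measurable_row_open oB; congr measurable; apply/seteqP; split => t /=.
  by case=> _ ct i; have := ct 0 i; rewrite mxE.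
by move=> ct; split => // i j; rewrite (ord1 i) mxE; exact: ct.
Qed.

Lemma cube_gt0 n (c : 'rV[R]_n) (e : R) : 0 < e -> (0 < mu n (cube c e))%E.
Proof.
move=> e0; elim: n c => [|n IHn] c.
  by rewrite /= diracE mem_set/= ?lte01// => -[].
rewrite /= /lebesgue_cons /pushforward.
pose c' : 'rV[R]_n := \row_i c 0 (lift ord0 i).
rewrite (_ : _ @^-1` _ = ball (c 0 ord0 : R) e `*` cube c' e).
  rewrite product_measure1E; last exact: measurable_cube.
    apply: mule_gt0; last exact: IHn.
    have lb := lebesgue_measure_ball (c 0 ord0) (ltW e0).
    by rewrite [X in (_ < X)%E]lb lte_fin mulrn_wgt0.
  by apply: open_measurable; exact: ball_open.
apply/seteqP; split => -[a t] /=.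
  move=> H; split; first by have := H ord0; rewrite tnth_tcons0.
  by move=> i; have := H (lift ord0 i); rewrite tnth_tconsS mxE.
move=> [H0 H] i; have [j ->|->] := unliftP ord0 i; last by rewrite tnth_tcons0.
by have := H j; rewrite tnth_tconsS mxE.
Qed.

Lemma integral_continuous_eq0 n (g : 'rV[R]_n -> R) : continuous g ->
  (forall y, 0 <= g y) -> (\int[mu n]_t (g (row_of t))%:E = 0)%E ->
  forall y, g y = 0.
Proof.
move=> cg g0 I0 y; apply: contrapT => /eqP gy.
have gy0 : 0 < g y by rewrite lt_neqAle eq_sym gy g0.
have mg : measurable_fun setT (EFin \o (fun t : n.-tuple rT => g (row_of t))).
  by apply/measurable_EFinP; exact: measurable_row_fun.
have [+ _] := ae_eq_integral_abs (mu n) measurableT mg.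
under eq_integral => t _ do rewrite /= ger0_norm//.
move=> /(_ I0)[N [mN N0 sN]].
have : \forall z \near y, 0 < g z by have /cvgr_gt := cg y; exact.
move=> /nbhs_ballP[e /= e0 ye].
have : (mu n (cube y e) <= mu n N)%E.
  apply: le_measure; rewrite ?inE//; first exact: measurable_cube.
  apply: subset_trans sN => t /= Ct.
  move=> /(_ I) /eqP; rewrite eqe gt_eqF//; apply: ye; split => // i j.
  by rewrite (ord1 i) mxE; exact: Ct.
by rewrite N0 leNgt cube_gt0.
Qed.

End lebesgue_tuple.

(** * The stereographic chart *)

Section stereographic_chart.
Context (R : realType) (n : nat).
Implicit Types (y : 'rV[R]_n) (i j : 'I_n) (k l : 'I_n.+1) (f : sphere R n -> R).

(** The conformal factor: the metric of the chart is [rho ^+ 2] times the flat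
    one. *)
Definition rho y : R := 2 / (1 + dot y y).

Lemma dot_ge0 (N : nat) (y : 'rV[R]_N) : 0 <= dot y y.
Proof. by apply: sumr_ge0 => i _; rewrite -expr2 sqr_ge0. Qed.

Lemma one_dot_gt0 y : 0 < 1 + dot y y.
Proof. by rewrite ltr_pwDl// dot_ge0. Qed.

Lemma rho_gt0 y : 0 < rho y.
Proof. by rewrite divr_gt0// one_dot_gt0. Qed.

Lemma stereo0 y : stereo y 0 ord0 = 1 - rho y.
Proof.
have -> : (ord0 : 'I_n.+1) = lshift n (ord0 : 'I_1) :> 'I_(1 + n) by exact/val_inj.
rewrite /stereo mxE (@row_mxEl _ 1 1 n) mxE eqxx mulr1n /rho; field.
by rewrite gt_eqF// one_dot_gt0.
Qed.

Lemma stereoS y j : stereo y 0 (lift ord0 j) = rho y * y 0 j.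
Proof.
have -> : (lift ord0 j : 'I_n.+1) = rshift 1 j :> 'I_(1 + n) by exact/val_inj.
rewrite /stereo mxE (@row_mxEr _ 1 1 n) mxE /rho; field.
by rewrite gt_eqF// one_dot_gt0.
Qed.

Lemma is_derive_rho y i : is_derive y (basis_vec R i) rho (- rho y ^+ 2 * y 0 i).
Proof.
rewrite -(addr0 y) -(scale0r (basis_vec R i)); apply/is_derive_line.
rewrite scale0r addr0.
pose p (s : R) := 1 + dot y y + s * (2 * y 0 i) + s * s.
have pE s : 1 + dot (y + s *: basis_vec R i) (y + s *: basis_vec R i) = p s.
  have -> : dot (y + s *: basis_vec R i) (y + s *: basis_vec R i) =
     dot y y + \sum_j (j == i)%:R * (s * (2 * y 0 j) + s * s).
    rewrite /dot -big_split/=; apply: eq_bigr => j _; rewrite !mxE eqxx/=.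
    by case: (j == i) => /=; ring.
  rewrite (bigD1 i)//= eqxx big1 => [|j /negbTE ->]; last exact: mul0r.
  by rewrite /p /=; ring.
have dp : is_derive (0 : R) 1 p (2 * y 0 i).
  by apply: is_derive_eq; rewrite /GRing.scale/=; ring.
have p0 : p 0 = 1 + dot y y by rewrite /p; ring.
have pn0 : p 0 != 0 by rewrite p0 gt_eqF// one_dot_gt0.
rewrite (_ : (fun s : R => _) = (fun s => 2 * (p s)^-1)); last first.
  by apply/funext => s; rewrite /rho pE.
have := is_deriveM (is_derive_cst (2 : R) (0 : R) 1) (@is_deriveV _ p 0 _ 1 pn0 dp).
move=> /is_derive_eq; apply; rewrite scaler0 addr0 /GRing.scale/= p0 /rho; field.
by rewrite gt_eqF// one_dot_gt0.
Qed.

(** The partial derivatives of the coordinates of [stereo], and their own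
    derivatives in the same direction. *)
Definition dstereo i k y : R :=
  if unlift ord0 k is Some j then rho y * (i == j)%:R - rho y ^+ 2 * y 0 i * y 0 j
  else rho y ^+ 2 * y 0 i.

Definition ddstereo i k y : R :=
  if unlift ord0 k is Some j then
    - rho y ^+ 2 * y 0 i * (i == j)%:R
    - (rho y ^+ 2 * (y 0 j + y 0 i * (i == j)%:R)
       - 2 * rho y ^+ 3 * y 0 i ^+ 2 * y 0 j)
  else rho y ^+ 2 - 2 * rho y ^+ 3 * y 0 i ^+ 2.

Lemma dstereo0 i y : dstereo i ord0 y = rho y ^+ 2 * y 0 i.
Proof. by rewrite /dstereo unlift_none. Qed.

Lemma dstereoS i j y : dstereo i (lift ord0 j) y =
  rho y * (i == j)%:R - rho y ^+ 2 * y 0 i * y 0 j.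
Proof. by rewrite /dstereo liftK. Qed.

Let dcoord y i j : is_derive y (basis_vec R i) (fun y : 'rV[R]_n => y 0 j) ((i == j)%:R : R).
Proof. by have := is_derive_coord j y (basis_vec R i); rewrite mxE eqxx/= eq_sym. Qed.

Lemma is_derive_rhoX y i m : is_derive y (basis_vec R i) (fun y => rho y ^+ m)
  (- m%:R * rho y ^+ m.+1 * y 0 i).
Proof.
have := is_deriveX m (is_derive_rho y i); rewrite exprfctE => /is_derive_eq; apply.
by case: m => [|m]; rewrite /GRing.scale/= ?exprS; ring.
Qed.

Lemma is_derive_stereo y i k :
  is_derive y (basis_vec R i) (fun y => stereo y 0 k) (dstereo i k y).
Proof.
rewrite /dstereo; have [j ->|->] := unliftP ord0 k.
  rewrite (_ : (fun y => _) = rho * (fun y => y 0 j)); last first.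
    by apply/funext => z; rewrite stereoS.
  have /is_derive_eq := is_deriveM (is_derive_rho y i) (dcoord y i j); apply.
  by rewrite /GRing.scale/=; ring.
rewrite (_ : (fun y => _) = (fun=> 1) - rho); last first.
  by apply/funext => z; rewrite stereo0.
have /is_derive_eq := is_deriveB (is_derive_cst (1 : R) y (basis_vec R i)) (is_derive_rho y i).
by apply; ring.
Qed.

Lemma is_derive_dstereo y i k :
  is_derive y (basis_vec R i) (dstereo i k) (ddstereo i k y).
Proof.
rewrite /dstereo /ddstereo; have [j _|_] := unliftP ord0 k.
  have D1 := is_deriveM (is_derive_rho y i) (is_derive_cst ((i == j)%:R : R) y (basis_vec R i)).
  have D2 := is_deriveM (is_deriveM (is_derive_rhoX y i 2) (dcoord y i i)) (dcoord y i j).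
  have /is_derive_eq := is_deriveB D1 D2; apply.
  by rewrite /GRing.scale/= eqxx/= mulrfctE; ring.
have /is_derive_eq := is_deriveM (is_derive_rhoX y i 2) (dcoord y i i); apply.
by rewrite /GRing.scale/= eqxx/=; ring.
Qed.

Lemma is_derive_chart f y i : smooth f ->
  is_derive y (basis_vec R i) (fun y => f (stereo_chart y))
    (\sum_k dstereo i k y * tder k f (stereo_chart y)).
Proof.
move=> sf; rewrite -(addr0 y) -(scale0r (basis_vec R i)); apply/is_derive_line.
apply: (@is_derive_smooth_curve _ _ f (fun s => stereo_chart (y + s *: basis_vec R i))) => // k.
by apply/(@is_derive_line _ _ _ (fun y => stereo y 0 k)); exact: is_derive_stereo.
Qed.

Let dotE y : dot y y = 2 / rho y - 1.
Proof. by rewrite /rho; field; rewrite gt_eqF// one_dot_gt0. Qed.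

Let rho_neq0 y : rho y != 0.
Proof. by rewrite gt_eqF// rho_gt0. Qed.

Lemma sum_dstereo2 y k l :
  \sum_i dstereo i k y * dstereo i l y =
  rho y ^+ 2 * ((k == l)%:R - stereo y 0 k * stereo y 0 l).
Proof.
have S0 j : \sum_i dstereo i ord0 y * dstereo i (lift ord0 j) y =
    rho y ^+ 2 * (0 - (1 - rho y) * (rho y * y 0 j)).
  rewrite (eq_bigr (fun i => (i == j)%:R * (rho y ^+ 3 * y 0 i)
    - rho y ^+ 4 * y 0 j * (y 0 i * y 0 i))); last first.
    by move=> i _; rewrite dstereo0 dstereoS; ring.
  by rewrite sumrB sum_delta -mulr_sumr -/(dot y y) dotE; field.
have [j ->|->] := unliftP ord0 k; have [j' ->|->] := unliftP ord0 l.
- rewrite (eq_bigr (fun i => (i == j)%:R * (rho y ^+ 2 * (i == j')%:R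
    - rho y ^+ 3 * (y 0 i * y 0 j')) - (i == j')%:R * (rho y ^+ 3 * (y 0 i * y 0 j))
    + rho y ^+ 4 * y 0 j * y 0 j' * (y 0 i * y 0 i))); last first.
    by move=> i _; rewrite !dstereoS; ring.
  rewrite big_split/= sumrB !sum_delta -mulr_sumr -/(dot y y) dotE !stereoS.
  by rewrite (inj_eq lift_inj); field.
- under eq_bigr do rewrite mulrC.
  by rewrite S0 eq_sym (negbTE (neq_lift _ _)) stereo0 stereoS /=; ring.
- by rewrite S0 (negbTE (neq_lift _ _)) stereo0 stereoS /=; ring.
rewrite (eq_bigr (fun i => rho y ^+ 4 * (y 0 i * y 0 i))).
  by rewrite -mulr_sumr -/(dot y y) dotE eqxx stereo0 /=; field.
by move=> i _; rewrite dstereo0; ring.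
Qed.

Lemma dstereo_ortho y i j :
  \sum_k dstereo i k y * dstereo j k y = rho y ^+ 2 * (i == j)%:R.
Proof.
rewrite big_ord_recl !dstereo0.
rewrite (eq_bigr (fun k : 'I_n => (k == i)%:R * (rho y ^+ 2 * (k == j)%:R
    - rho y ^+ 3 * (y 0 k * y 0 j)) - (k == j)%:R * (rho y ^+ 3 * (y 0 k * y 0 i))
    + rho y ^+ 4 * y 0 i * y 0 j * (y 0 k * y 0 k))); last first.
  by move=> k _; rewrite !dstereoS (eq_sym i) (eq_sym j); ring.
rewrite big_split/= sumrB !sum_delta -mulr_sumr -/(dot y y) dotE.
by field.
Qed.

Lemma sum_ddstereo y k m : n = m.+2 ->
  \sum_i (- m%:R * rho y * y 0 i * dstereo i k y + ddstereo i k y) =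
  - n%:R * rho y ^+ 2 * stereo y 0 k.
Proof.
move=> nm; have nE : n%:R = m%:R + 2 :> R by rewrite nm -addn2 natrD.
have [j ->|->] := unliftP ord0 k.
  rewrite (eq_bigr (fun i => (i == j)%:R * (- (m%:R + 2) * rho y ^+ 2 * y 0 i)
    + (m%:R + 2) * rho y ^+ 3 * y 0 j * (y 0 i * y 0 i) + - rho y ^+ 2 * y 0 j)).
    rewrite !big_split/= sum_delta -mulr_sumr -/(dot y y) dotE sumr_const card_ord.
    by rewrite -[(_ * _) *+ n]mulr_natr nE stereoS; field.
  by move=> i _; rewrite dstereoS /ddstereo liftK; ring.
rewrite (eq_bigr (fun i => - (m%:R + 2) * rho y ^+ 3 * (y 0 i * y 0 i) + rho y ^+ 2)).
  rewrite big_split/= -mulr_sumr -/(dot y y) dotE sumr_const card_ord.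
  by rewrite -[(_ ^+ 2) *+ n]mulr_natr nE stereo0; field.
by move=> i _; rewrite dstereo0 /ddstereo unlift_none; ring.
Qed.

Lemma sqrt_det_chart_metric y : Num.sqrt (\det (chart_metric y)) = rho y ^+ n.
Proof.
have -> : chart_metric y = (rho y ^+ 2)%:M.
  apply/matrixP => i j; rewrite !mxE -mulr_natr -dstereo_ortho /dot.
  have D i' : 'D_(basis_vec R i') (@stereo R n) y = \row_k dstereo i' k y.
    have : is_derive y (basis_vec R i') (@stereo R n) (\row_k dstereo i' k y).
      rewrite -{1}(addr0 y) -(scale0r (basis_vec R i')); apply/is_derive_line.
      apply: is_derive_row => k; apply/(@is_derive_line _ _ _ (fun y => stereo y 0 k)).
      by rewrite scale0r addr0; exact: is_derive_stereo.
    by case.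
  by apply: eq_bigr => k _; rewrite !D !mxE.
rewrite det_scalar -exprM mulnC exprM sqrtr_sqr ger0_norm// exprn_ge0//.
by rewrite ltW// rho_gt0.
Qed.

End stereographic_chart.

(** * The divergence theorem on the sphere *)

Section sphere_integral.
Context (R : realType) (n : nat).
Implicit Types (y : 'rV[R]_n) (i j : 'I_n) (k l : 'I_n.+1) (f : sphere R n -> R).
Local Notation rT := (measurableTypeR R).
Local Notation lam := (@lebesgue_measure R).
Local Notation mu := (lebesgue_tuple R n).

Let contD (f g : 'rV[R]_n -> R) : continuous f -> continuous g ->
  continuous (fun y => f y + g y).
Proof. by move=> cf cg y; apply: continuousD; [exact: cf|exact: cg]. Qed.

Let contB (f g : 'rV[R]_n -> R) : continuous f -> continuous g ->
  continuous (fun y => f y - g y).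
Proof. by move=> cf cg y; apply: continuousB; [exact: cf|exact: cg]. Qed.

Let contM (f g : 'rV[R]_n -> R) : continuous f -> continuous g ->
  continuous (fun y => f y * g y).
Proof. by move=> cf cg y; apply: continuousM; [exact: cf|exact: cg]. Qed.

Let cont_cst (c : R) : continuous (fun _ : 'rV[R]_n => c).
Proof. exact: cst_continuous. Qed.

Let cont_coord i : continuous (fun y : 'rV[R]_n => y 0 i).
Proof. exact: coord_continuous. Qed.

Lemma continuous_dot (N : nat) : continuous (fun y : 'rV[R]_N => dot y y).
Proof.
rewrite /dot; apply: continuous_big => [|i _]; first exact: add_continuous.
by move=> y; apply: continuousM; exact: coord_continuous.
Qed.

Lemma continuous_rho : continuous (@rho R n).
Proof.
move=> y.
have c1 : {for y, continuous (fun y : 'rV[R]_n => 1 + dot y y)}.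
  by apply: continuousD; [exact: cst_continuous|exact: continuous_dot].
have c2 : {for y, continuous (fun y : 'rV[R]_n => (1 + dot y y)^-1)}.
  by apply: (cvgV _ c1); rewrite gt_eqF// one_dot_gt0.
by apply: (continuousM (s := fun=> 2) _ c2); exact: cst_continuous.
Qed.

Lemma continuous_rhoX m : continuous (fun y : 'rV[R]_n => rho y ^+ m).
Proof.
move=> y; apply: (@continuous_comp _ _ _ (@rho R n) (fun a => a ^+ m)).
  exact: continuous_rho.
exact: exprn_continuous.
Qed.

Lemma continuous_stereo : continuous (@stereo R n).
Proof.
apply: continuous_row => k; have [j ->|->] := unliftP ord0 k.
  rewrite (_ : (fun y => _) = fun y : 'rV[R]_n => rho y * y 0 j); last first.
    by apply/funext => y; rewrite stereoS.
  by move=> y; apply: continuousM; [exact: continuous_rho|exact: coord_continuous].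
rewrite (_ : (fun y => _) = fun y : 'rV[R]_n => 1 - rho y); last first.
  by apply/funext => y; rewrite stereo0.
by move=> y; apply: continuousB; [exact: cst_continuous|exact: continuous_rho].
Qed.

Lemma continuous_chart f : smooth f -> continuous (fun y => f (stereo_chart y)).
Proof.
move=> sf y; have [U [F [oU Uy CF fF]]] := sf (stereo_chart y).
have cF : {for y, continuous (fun z => F (@stereo R n z))}.
  apply: (@continuous_comp _ _ _ (@stereo R n) F); first exact: continuous_stereo.
  by have [+ _] := CF 0%N; apply.
apply: near_eq_continuous cF; have nU : nbhs (stereo y) U by exact: open_nbhs_nbhs.
have nV : \forall z \near y, U (@stereo R n z) := continuous_stereo nU.
have FE z : U (stereo z) -> F (stereo z) = f (stereo_chart z).
  by move=> Uz; rewrite (fF (stereo_chart z)).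
exact: filterS nV.
Qed.

Lemma smooth_bounded f : smooth f -> exists2 M : R, 0 <= M & forall x, `|f x| <= M.
Proof.
move=> sf; pose K := [set y : 'rV[R]_n.+1 | dot y y = 1].
have cK : compact K.
  apply: bounded_closed_compact.
    exists 1; split => // M M1 y /= Ky; apply: rV_norm_le => [|j].
      by rewrite (le_trans _ (ltW M1)).
    rewrite (le_trans _ (ltW M1))// -(ler_pXn2r (ltn0Sn 1))// ?nnegrE//.
    rewrite expr1n -normrX ger0_norm ?sqr_ge0// -Ky /dot (bigD1 j)//= expr2.
    by rewrite lerDl sumr_ge0// => i _; rewrite -expr2 sqr_ge0.
  rewrite (_ : K = (fun y : 'rV[R]_n.+1 => dot y y) @^-1` [set 1]) //.
  apply: preimage_closed => [y _|]; first exact: continuous_dot.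
  exact: closed_eq.
have cF : {within K, continuous (fun y : 'rV[R]_n.+1 => f (radial y))}.
  apply/subspace_continuousP => y Ky.
  have Sy : dot y y == 1 by apply/eqP.
  pose x : sphere R n := exist _ y Sy.
  have [U [F [oU Uy CF fF]]] := sf x.
  have fE z : K z -> U z -> f (radial z) = F z.
    move=> Kz Uz; have Sz : dot z z == 1 by apply/eqP.
    by have := radial_sphere (exist _ z Sz : sphere R n) => /= ->; rewrite fF.
  have cF : F z @[z --> within K (nbhs y)] --> F y.
    by apply: cvg_within_filter; have [+ _] := CF 0%N; apply.
  suff : f (radial z) @[z --> within K (nbhs y)] --> F y by rewrite -(fE y Ky Uy).
  apply: cvg_trans cF; apply: near_eq_cvg.
  rewrite near_withinE; near=> z => Kz; rewrite fE//.
  by near: z; exact: open_nbhs_nbhs.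
have [M [_ HM]] := compact_bounded (continuous_compact cF cK).
exists (`|M| + 1) => [|x]; first by rewrite addr_ge0.
have M1 : M < `|M| + 1 by rewrite (le_lt_trans (ler_norm _))// ltrDl.
apply: (HM _ M1); exists (val x); first exact: dot_sphere.
by rewrite radial_sphere.
Unshelve. all: by end_near. Qed.

(** The factor 2 makes the radius dominate [1 + `|y 0 i|] for each [i]. *)
Definition radius y : R := Num.sqrt (2 * (1 + dot y y)).

Lemma radius_sqr y : radius y ^+ 2 = 2 * (1 + dot y y).
Proof. by rewrite sqr_sqrtr// mulr_ge0// ltW// one_dot_gt0. Qed.

Lemma rho_radius y : rho y * radius y ^+ 2 = 4.
Proof. by rewrite radius_sqr /rho; field; rewrite gt_eqF// one_dot_gt0. Qed.

Lemma coord_sqr_le y i : y 0 i ^+ 2 <= dot y y.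
Proof.
rewrite /dot (bigD1 i)//= -expr2 lerDl sumr_ge0// => j _.
by rewrite -expr2 sqr_ge0.
Qed.

Lemma radius_ge1 y : 1 <= radius y.
Proof.
rewrite -(sqrtr1 R) ler_wsqrtr//; have := dot_ge0 y; lra.
Qed.

Lemma coord_radius y i : 1 + `|y 0 i| <= radius y.
Proof.
rewrite -(ler_pXn2r (ltn0Sn 1)) ?nnegrE ?addr_ge0 ?sqrtr_ge0//.
have h : `|y 0 i| ^+ 2 <= dot y y by rewrite real_normK ?num_real// coord_sqr_le.
have : 0 <= (`|y 0 i| - 1) ^+ 2 by rewrite sqr_ge0.
by rewrite radius_sqr; move: `|y 0 i| (dot y y) h => a d; nra.
Qed.

Lemma coord_le_radius y i : `|y 0 i| <= radius y.
Proof. by apply: le_trans (coord_radius y i); rewrite lerDr. Qed.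

Lemma rho_le2 y : rho y <= 2.
Proof.
rewrite ler_pdivrMr ?one_dot_gt0//; have := dot_ge0 y; lra.
Qed.

Lemma rho_coord2 y i j : rho y * (`|y 0 i| * `|y 0 j|) <= 4.
Proof.
rewrite -(rho_radius y); apply: ler_wpM2l; first by rewrite ltW// rho_gt0.
rewrite expr2.
by apply: ler_pM => //; exact: coord_le_radius.
Qed.

Lemma rho_coord y i : rho y * `|y 0 i| <= 4.
Proof.
rewrite -(rho_radius y); apply: ler_wpM2l; first by rewrite ltW// rho_gt0.
rewrite expr2.
have := coord_radius y i; have := radius_ge1 y; have := normr_ge0 (y 0 i).
by move: `|_| (radius y) => a q; nra.
Qed.

(** Every integrand below is at most a multiple of the left-hand side, which
    decays like the power [1 - 2 * n] of the radius, while the product of the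
    weights decays no faster than the power [- 3 / 2 * n]: this is where the
    dimension has to be at least 2. *)
Lemma rho_weight y : (1 < n)%N ->
  rho y ^+ n * radius y <= 4 ^+ n * \prod_(i < n) weight (y 0 i).
Proof.
move=> n1; set q := radius y; set r := Num.sqrt q.
have q1 : 1 <= q by exact: radius_ge1.
have q0 : 0 < q by exact: lt_le_trans ltr01 q1.
have r1 : 1 <= r by rewrite -(sqrtr1 R) ler_wsqrtr.
have r0 : 0 < r by exact: lt_le_trans ltr01 r1.
have rq : r ^+ 2 = q by rewrite sqr_sqrtr// ltW.
have wi i : (q * r)^-1 <= weight (y 0 i).
  have w0 := weight_gt0 (y 0 i); rewrite invr_gt0 in w0.
  rewrite /weight lef_pV2 ?posrE//; last exact: mulr_gt0.
  apply: ler_pM; rewrite ?sqrtr_ge0 ?addr_ge0//; first exact: coord_radius.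
  by rewrite ler_wsqrtr// coord_radius.
have pw : (q * r)^-1 ^+ n <= \prod_(i < n) weight (y 0 i).
  rewrite -[X in _ ^+ X]card_ord -prodr_const; apply: ler_prod => /= j _.
  by rewrite wi invr_ge0 mulr_ge0// ltW.
apply: le_trans (ler_wpM2l _ pw); last by rewrite exprn_ge0.
have -> : rho y = 4 / q ^+ 2.
  by rewrite -(rho_radius y) -/q mulfK// expf_neq0// gt_eqF.
rewrite exprMn -mulrA; apply: ler_wpM2l; first by rewrite exprn_ge0.
have qrn : 0 < (q * r) ^+ n by rewrite exprn_gt0// mulr_gt0.
have q2n : 0 < (q ^+ 2) ^+ n by rewrite !exprn_gt0.
rewrite !exprVn -[X in _ <= X]mul1r ler_pdivlMr// -mulrA mulrC ler_pdivrMr// mul1r.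
rewrite -rq -[X in (X * r) ^+ _]/(r ^+ 2) -exprSr -!exprM -exprD ler_weXn2l//.
by move: n1; clear; lia.
Qed.

Hypothesis n1 : (1 < n)%N.

Lemma dominated_integrable (g : 'rV[R]_n -> R) (C : R) : continuous g ->
  (forall y, `|g y| <= C * (rho y ^+ n * radius y)) ->
  mu.-integrable setT (EFin \o (fun t => g (row_of t))).
Proof.
move=> cg gC.
have C0 : 0 <= C.
  have p0 : 0 < rho (0 : 'rV[R]_n) ^+ n * radius 0.
    by rewrite mulr_gt0 ?exprn_gt0 ?rho_gt0// (lt_le_trans ltr01 (radius_ge1 _)).
  by rewrite -(pmulr_lge0 _ p0) (le_trans _ (gC 0)).
have ip := integrable_prod n (fun a => ltW (weight_gt0 a)) (integrable_weight R).
apply: (le_integrable measurableT _ _ (integrableZl measurableT (C * 4 ^+ n) ip)).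
  by apply/measurable_EFinP; exact: measurable_row_fun.
move=> t _ /=; rewrite lee_fin (le_trans (gC _))// -mulrA.
rewrite ger0_norm ?mulr_ge0 ?exprn_ge0 ?prodr_ge0//; last first.
  by move=> i _; rewrite ltW// weight_gt0.
apply: ler_wpM2l => //.
rewrite (eq_bigr (fun i => weight (row_of t 0 i))); first exact: rho_weight.
by move=> i _; rewrite mxE.
Qed.

Lemma dstereo_le i k y : `|dstereo i k y| <= 5 * rho y.
Proof.
have r0 := ltW (rho_gt0 y); rewrite /dstereo; have [j _|_] := unliftP ord0 k; last first.
  rewrite normrM normrX ger0_norm// expr2 -mulrA mulrC ler_wpM2r//.
  by have := rho_coord y i; lra.
apply: (@le_trans _ _ (rho y * 1 + rho y * 4)); last by lra.
apply: (le_trans (ler_normB _ _)); apply: lerD.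
  rewrite normrM ger0_norm//; apply: ler_wpM2l => //.
  by case: eqP; rewrite ?normr1 ?normr0.
rewrite normrM normrM normrX (ger0_norm r0).
have -> : rho y ^+ 2 * `|y 0 i| * `|y 0 j| = rho y * (rho y * (`|y 0 i| * `|y 0 j|)).
  by ring.
by apply: ler_wpM2l => //; exact: rho_coord2.
Qed.

Lemma ddstereo_le i k y : `|ddstereo i k y| <= 23 * (rho y ^+ 2 * radius y).
Proof.
have r0 := ltW (rho_gt0 y); have r2 := exprn_ge0 2 r0.
have q1 := radius_ge1 y.
have yy : rho y * y 0 i ^+ 2 <= 4.
  have := rho_coord2 y i i; rewrite -expr2 real_normK ?num_real//.
have yy0 : 0 <= rho y * y 0 i ^+ 2 by rewrite mulr_ge0// sqr_ge0.
have rX (c : R) : `|rho y ^+ 2 * c| = rho y ^+ 2 * `|c| by rewrite normrM ger0_norm.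
rewrite /ddstereo; have [j _|_] := unliftP ord0 k.
  set d : R := (_ == _)%:R.
  have d1 : `|d| <= 1 by rewrite /d; case: eqP; rewrite ?normr1 ?normr0.
  have -> : - rho y ^+ 2 * y 0 i * d - (rho y ^+ 2 * (y 0 j + y 0 i * d) -
      2 * rho y ^+ 3 * y 0 i ^+ 2 * y 0 j) =
      rho y ^+ 2 * (- 2 * (y 0 i * d) - y 0 j + 2 * (rho y * y 0 i ^+ 2) * y 0 j).
    by ring.
  rewrite rX [X in _ <= X]mulrCA; apply: ler_wpM2l => //.
  have yi : `|y 0 i * d| <= radius y.
    by rewrite normrM -[radius y]mulr1; apply: ler_pM => //; exact: coord_le_radius.
  have yj := coord_le_radius y j.
  apply: (@le_trans _ _ (2 * radius y + radius y + 2 * 4 * radius y)); last by lra.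
  apply: (le_trans (ler_normD _ _)); apply: lerD.
    apply: (le_trans (ler_normB _ _)); apply: lerD => //.
    by rewrite normrM normrN normr_nat; lra.
  rewrite normrM; apply: ler_pM => //.
  by rewrite normrM normr_nat (ger0_norm yy0); lra.
have -> : rho y ^+ 2 - 2 * rho y ^+ 3 * y 0 i ^+ 2 =
    rho y ^+ 2 * (1 - 2 * (rho y * y 0 i ^+ 2)) by ring.
rewrite rX [X in _ <= X]mulrCA; apply: ler_wpM2l => //.
apply: (le_trans (ler_normB _ _)); rewrite normr1 normrM normr_nat (ger0_norm yy0).
by lra.
Qed.

(** For [m = n - 2], the [i]-th component, in the chart, of the vector density
    of the field on the sphere that projects [f] times the [k]-th basis vector:
    the component of the field is [rho ^- 2 * dstereo i k * f], and the
    Riemannian density is [rho ^+ n]. *)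
Definition chart_field m i k f y : R := rho y ^+ m * (dstereo i k y * f (stereo_chart y)).

Definition chart_field_der m i k f y : R :=
  rho y ^+ m * ((- m%:R * rho y * y 0 i * dstereo i k y + ddstereo i k y) * f (stereo_chart y)
    + dstereo i k y * \sum_l dstereo i l y * tder l f (stereo_chart y)).

Lemma is_derive_chart_field m i k f y : smooth f ->
  is_derive y (basis_vec R i) (chart_field m i k f) (chart_field_der m i k f y).
Proof.
move=> sf.
have := is_deriveM (is_derive_rhoX y i m)
  (is_deriveM (is_derive_dstereo y i k) (is_derive_chart y i sf)).
move=> /is_derive_eq; apply; rewrite /chart_field_der /GRing.scale/= mulrfctE exprS; ring.
Qed.

Lemma sum_chart_field_der m k f y : n = m.+2 -> smooth f ->
  \sum_i chart_field_der m i k f y = rho y ^+ n *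
    (tder k f (stereo_chart y) - n%:R * (stereo y 0 k * f (stereo_chart y))).
Proof.
move=> nm sf; set x := stereo_chart y.
have rn : rho y ^+ n = rho y ^+ m * rho y ^+ 2 by rewrite -exprD addn2 -nm.
rewrite (eq_bigr (fun i => rho y ^+ m * f x *
   (- m%:R * rho y * y 0 i * dstereo i k y + ddstereo i k y)
   + \sum_l rho y ^+ m * tder l f x * (dstereo i k y * dstereo i l y))); last first.
  move=> i _; rewrite /chart_field_der !mulr_sumr mulrDr mulr_sumr; congr (_ + _).
    by rewrite mulrCA mulrA; ring.
  by apply: eq_bigr => l _; ring.
rewrite big_split/= -mulr_sumr sum_ddstereo// exchange_big/=.
under [X in _ + X]eq_bigr do rewrite -mulr_sumr sum_dstereo2.
rewrite (eq_bigr (fun l => (l == k)%:R * (rho y ^+ n * tder l f x)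
   - rho y ^+ n * stereo y 0 k * (val x 0 l * tder l f x))); last first.
  by move=> l _; rewrite rn (eq_sym k) /=; ring.
rewrite sumrB -mulr_sumr coord_tder// mulr0 subr0.
rewrite (bigD1 k)//= eqxx big1 ?addr0 => [|l /negbTE ->]; last exact: mul0r.
rewrite rn /=; ring.
Qed.

Lemma continuous_dstereo i k : continuous (@dstereo R n i k).
Proof.
have cX m := continuous_rhoX m.
have [j ->|->] := unliftP ord0 k.
  rewrite (_ : dstereo _ _ = (fun y => rho y * (i == j)%:R - rho y ^+ 2 * y 0 i * y 0 j)).
    apply: contB; first by apply: contM; [exact: continuous_rho|exact: cont_cst].
    by apply: contM; [apply: contM; [exact: cX|exact: cont_coord]|exact: cont_coord].
  by apply/funext => y; rewrite dstereoS.
rewrite (_ : dstereo _ _ = (fun y => rho y ^+ 2 * y 0 i)).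
  by apply: contM; [exact: cX|exact: cont_coord].
by apply/funext => y; rewrite dstereo0.
Qed.

Lemma continuous_ddstereo i k : continuous (@ddstereo R n i k).
Proof.
have cX m := continuous_rhoX m.
have c3 : continuous (fun y : 'rV[R]_n => rho y ^+ 3 * (y 0 i * y 0 i)).
  by apply: contM; [exact: cX|apply: contM; exact: cont_coord].
have [j ->|->] := unliftP ord0 k.
  rewrite (_ : ddstereo _ _ = (fun y => rho y ^+ 2 * y 0 i * (- 2 * (i == j)%:R)
     + (rho y ^+ 3 * (y 0 i * y 0 i) * (2 * y 0 j) - rho y ^+ 2 * y 0 j))).
    apply: contD.
      by apply: contM; [apply: contM; [exact: cX|exact: cont_coord]|exact: cont_cst].
    apply: contB; last by apply: contM; [exact: cX|exact: cont_coord].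
    by apply: contM; [exact: c3|apply: contM; [exact: cont_cst|exact: cont_coord]].
  by apply/funext => y; rewrite /ddstereo liftK; ring.
rewrite (_ : ddstereo _ _ = (fun y => rho y ^+ 2 - rho y ^+ 3 * (y 0 i * y 0 i) * 2)).
  apply: contB; first exact: cX.
  by apply: contM; [exact: c3|exact: cont_cst].
by apply/funext => y; rewrite /ddstereo unlift_none; ring.
Qed.

Lemma continuous_chart_field_der m i k f : smooth f ->
  continuous (chart_field_der m i k f).
Proof.
move=> sf.
have cf := continuous_chart sf.
have cs : continuous (fun y => \sum_l dstereo i l y * tder l f (stereo_chart y)).
  apply: continuous_big => [|l _]; first exact: add_continuous.
  apply: contM; first exact: continuous_dstereo.
  by apply: continuous_chart; exact: smooth_tder.
rewrite (_ : chart_field_der _ _ _ _ = (fun y => rho y ^+ m *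
   ((- m%:R * (rho y * (y 0 i * dstereo i k y)) + ddstereo i k y) * f (stereo_chart y)
    + dstereo i k y * \sum_l dstereo i l y * tder l f (stereo_chart y)))); last first.
  by apply/funext => y; rewrite /chart_field_der !mulrA.
apply: contM; first exact: continuous_rhoX.
apply: contD; last by apply: contM; [exact: continuous_dstereo|exact: cs].
apply: contM; last exact: cf.
apply: contD; last exact: continuous_ddstereo.
apply: contM; first exact: cont_cst.
apply: contM; first exact: continuous_rho.
by apply: contM; [exact: cont_coord|exact: continuous_dstereo].
Qed.

Lemma chart_field_der_le m i k f : n = m.+2 -> smooth f ->
  exists C : R, forall y, `|chart_field_der m i k f y| <= C * (rho y ^+ n * radius y).
Proof.
move=> nm sf; have [M M0 fM] := smooth_bounded sf.
have [B B0 fB] : exists2 B : R, 0 <= B & forall l x, `|tder l f x| <= B.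
  have bd l : exists M : R, 0 <= M /\ forall x, `|tder l f x| <= M.
    by have [N N0 H] := smooth_bounded (smooth_tder l sf); exists N.
  have [N NP] := choice bd; exists (\sum_l N l).
    by apply: sumr_ge0 => l _; have [] := NP l.
  move=> l x; have [_ /(_ x)] := NP l; move=> /le_trans; apply.
  by rewrite (bigD1 l)//= lerDl sumr_ge0// => l' _; have [] := NP l'.
exists ((m%:R * 5 + 23) * M + 25 * (n.+1%:R * B)) => y.
have r0 := rho_gt0 y; have q1 := radius_ge1 y.
have rq0 : 0 < rho y ^+ 2 * radius y.
  by rewrite mulr_gt0 ?exprn_gt0// (lt_le_trans ltr01).
have E1 : `|- m%:R * rho y * y 0 i * dstereo i k y| <= m%:R * 5 * (rho y ^+ 2 * radius y).
  rewrite 3!normrM normrN normr_nat (ger0_norm (ltW r0)).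
  have := dstereo_le i k y; have := coord_le_radius y i.
  move: `|y 0 i| `|dstereo i k y| (normr_ge0 (y 0 i)) (normr_ge0 (dstereo i k y)).
  move=> a d a0 d0 aq dr.
  have -> : m%:R * rho y * a * d = m%:R * (rho y * (a * d)) by ring.
  have -> : m%:R * 5 * (rho y ^+ 2 * radius y) =
    m%:R * (rho y * (radius y * (5 * rho y))) by ring.
  by apply: ler_wpM2l => //; apply: ler_wpM2l; [exact: ltW|exact: ler_pM].
have E2 : `|\sum_l dstereo i l y * tder l f (stereo_chart y)| <= 5 * rho y * (n.+1%:R * B).
  apply: (le_trans (ler_norm_sum _ _ _)).
  have -> : 5 * rho y * (n.+1%:R * B) = \sum_(l < n.+1) 5 * rho y * B.
    by rewrite sumr_const card_ord -mulr_natr; ring.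
  apply: ler_sum => l _; rewrite normrM; apply: ler_pM => //.
  exact: dstereo_le.
rewrite /chart_field_der normrM ger0_norm ?exprn_ge0 ?(ltW r0)//.
have -> : ((m%:R * 5 + 23) * M + 25 * (n.+1%:R * B)) * (rho y ^+ n * radius y) =
   rho y ^+ m * ((m%:R * 5 * (rho y ^+ 2 * radius y) + 23 * (rho y ^+ 2 * radius y)) * M
     + 25 * (n.+1%:R * B) * (rho y ^+ 2 * radius y)).
  have -> : rho y ^+ n = rho y ^+ m * rho y ^+ 2 by rewrite -exprD addn2 -nm.
  by ring.
apply: ler_wpM2l; first by rewrite exprn_ge0// ltW.
apply: (le_trans (ler_normD _ _)); apply: lerD.
  rewrite normrM; apply: ler_pM => //.
  by apply: (le_trans (ler_normD _ _)); apply: lerD => //; exact: ddstereo_le.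
rewrite normrM.
have -> : 25 * (n.+1%:R * B) * (rho y ^+ 2 * radius y) =
   (5 * rho y) * (5 * rho y * (n.+1%:R * B)) * radius y by ring.
apply: (@le_trans _ _ ((5 * rho y) * (5 * rho y * (n.+1%:R * B)))).
  by apply: ler_pM => //; exact: dstereo_le.
by apply: ler_peMr => //; move: (ltW r0); move: (rho y) => r r0'; rewrite !mulr_ge0.
Qed.

Lemma chart_field_le m i k f : smooth f ->
  exists2 C : R, 0 <= C & forall y, `|chart_field m i k f y| <= C * rho y.
Proof.
move=> sf; have [M M0 fM] := smooth_bounded sf.
exists (2 ^+ m * (5 * M)) => [|y]; first by rewrite !mulr_ge0 ?exprn_ge0.
have r0 := ltW (rho_gt0 y).
rewrite /chart_field normrM normrX (ger0_norm r0) normrM.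
have -> : 2 ^+ m * (5 * M) * rho y = 2 ^+ m * ((5 * rho y) * M) by ring.
have rm : rho y ^+ m <= 2 ^+ m by rewrite lerXn2r ?nnegrE// rho_le2.
apply: ler_pM rm _; [exact: exprn_ge0|exact: mulr_ge0|].
by apply: ler_pM => //; exact: dstereo_le.
Qed.

Lemma row_of_upd (t : n.-tuple rT) i (a : R) :
  row_of (upd t i a) = row_of (upd t i 0) + a *: basis_vec R i.
Proof.
apply/rowP => j; rewrite !mxE !tnth_mktuple eqxx/=.
by case: eqP => _; rewrite ?mulr1 ?mulr0 ?add0r ?addr0.
Qed.

(** On each line in the direction [i] the derivative of the field integrates to
    the difference of its limits at infinity, which are zero. *)
Lemma integral_chart_field_der m i k f : n = m.+2 -> smooth f ->
  (\int[mu]_t (chart_field_der m i k f (row_of t))%:E = 0)%E.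
Proof.
move=> nm sf; have [C HC] := chart_field_der_le i k nm sf.
have cv := @continuous_chart_field_der m i k f sf.
apply: (@integral_lines0 R n (fun t => chart_field_der m i k f (row_of t)) i).
  exact: dominated_integrable cv HC.
move=> t; pose y0 := row_of (upd t i 0).
pose c (a : R) := y0 + a *: basis_vec R i.
have cc : continuous c.
  apply: continuous_row => j.
  rewrite (_ : (fun a => _) = (fun a => y0 0 j + a * basis_vec R i 0 j)); last first.
    by apply/funext => a; rewrite !mxE.
  move=> a; apply: cvgD; first exact: cvg_cst.
  by apply: cvgM; [exact: cvg_id|exact: cvg_cst].
have dV (a : R) : is_derive a 1 (fun a => chart_field m i k f (c a))
    (chart_field_der m i k f (c a)).
  by apply/(@is_derive_line _ _ _ (chart_field m i k f)); exact: is_derive_chart_field.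
have cvc : continuous (fun a => chart_field_der m i k f (c a)).
  by move=> a; apply: (@continuous_comp _ _ _ c); [exact: cc|exact: cv].
have ci a : c a 0 i = a.
  by rewrite !mxE tnth_mktuple eqxx add0r mulr1.
have [B B0 HB] := chart_field_le m i k sf.
have rho_a (a : R) : rho (c a) * (1 + a ^+ 2) <= 2.
  rewrite /rho -mulrA ler_piMr// mulrC ler_pdivrMr ?one_dot_gt0// mul1r.
  by rewrite lerD2l -{1}(ci a) coord_sqr_le.
have lim0 (s : nat -> R) : (forall p, `|s p| = p.+1%:R) ->
    chart_field m i k f (c (s p)) @[p --> \oo] --> 0.
  move=> sp; apply/cvgrPdist_le => /= e e0.
  have e'0 : 0 < e / (2 * B + 1) by rewrite divr_gt0// ltr_wpDl// mulr_ge0.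
  have := near_infty_natSinv_lt (PosNum e'0); apply: filterS => p /= pe.
  rewrite sub0r normrN (le_trans (HB _))//.
  have p0 : 0 < p.+1%:R :> R by [].
  have : rho (c (s p)) <= 2 * p.+1%:R^-1.
    rewrite ler_pdivlMr//; apply: le_trans (rho_a (s p)).
    apply: ler_wpM2l; first by rewrite ltW// rho_gt0.
    by rewrite -(real_normK (num_real _)) sp; have : 1 <= p.+1%:R :> R by [rewrite ler1n]; nra.
  move=> /(ler_wpM2l B0) /le_trans; apply.
  move: pe; rewrite ltr_pdivlMr; last by rewrite ltr_wpDl// mulr_ge0.
  have : 0 < p.+1%:R^-1 :> R by rewrite invr_gt0.
  by move: (p.+1%:R^-1) => q; nra.
transitivity (\int[lam]_a (chart_field_der m i k f (c a))%:E)%E.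
  by apply: eq_integral => a _; rewrite row_of_upd.
apply: (@integral_derive0 R _ (fun a => chart_field m i k f (c a))) => //.
- have iw := integrableZl measurableT (`|C| * 4 ^+ n) (integrable_weight R).
  apply: (le_integrable measurableT _ _ iw).
    by apply/measurable_EFinP; exact: continuous_measurable_fun.
  move=> a _ /=; rewrite lee_fin (le_trans (HC _))//.
  have w0 := ltW (weight_gt0 a); have w40 : 0 <= `|C| * 4 ^+ n * weight a.
    by rewrite mulr_ge0// mulr_ge0// exprn_ge0.
  rewrite (ger0_norm w40).
  have X0 : 0 <= rho (c a) ^+ n * radius (c a).
    by rewrite mulr_ge0 ?sqrtr_ge0// exprn_ge0// ltW// rho_gt0.
  apply: (le_trans (ler_wpM2r X0 (ler_norm C))); rewrite -mulrA.
  apply: ler_wpM2l => //; apply: (le_trans (rho_weight _ n1)).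
  apply: ler_wpM2l; first exact: exprn_ge0.
  rewrite (bigD1 i)//= ci ler_piMr//; apply: prodr_ile1 => j _.
  rewrite ltW ?weight_gt0//= /weight invf_le1 ?mulr_gt0 ?sqrtr_gt0 ?ltr_pwDl//.
  have s1 : 1 <= Num.sqrt (1 + `|c a 0 j|) by rewrite -[X in X <= _](sqrtr1 R) ler_wsqrtr// lerDl.
  by rewrite -[X in X <= _]mul1r; apply: ler_pM => //; rewrite lerDl.
- by apply: lim0 => p; rewrite normr_nat.
- by apply: lim0 => p; rewrite normrN normr_nat.
Qed.

Lemma sphere_integrable f : smooth f -> mu.-integrable setT
  (EFin \o (fun t => f (stereo_chart (row_of t)) * rho (row_of t) ^+ n)).
Proof.
move=> sf; have [M M0 fM] := smooth_bounded sf.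
apply: (@dominated_integrable (fun y => f (stereo_chart y) * rho y ^+ n) M).
  by apply: contM; [exact: continuous_chart|exact: continuous_rhoX].
move=> y; have r0 := exprn_ge0 n (ltW (rho_gt0 y)).
rewrite normrM (ger0_norm r0); apply: ler_pM => //.
by rewrite ler_peMr// radius_ge1.
Qed.

Lemma sphere_intE f : sphere_int f =
  \int[mu]_t (f (stereo_chart (row_of t)) * rho (row_of t) ^+ n).
Proof.
rewrite /sphere_int; apply: eq_Rintegral => t _.
by rewrite /= sqrt_det_chart_metric.
Qed.

Lemma sphere_intD f g : smooth f -> smooth g ->
  sphere_int (fun x => f x + g x) = sphere_int f + sphere_int g.
Proof.
move=> sf sg; rewrite !sphere_intE -RintegralD//; try exact: sphere_integrable.
by apply: eq_Rintegral => t _; rewrite mulrDl.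
Qed.

Lemma sphere_intZ (c : R) f : smooth f ->
  sphere_int (fun x => c * f x) = c * sphere_int f.
Proof.
move=> sf; rewrite !sphere_intE -RintegralZl//; last exact: sphere_integrable.
by apply: eq_Rintegral => t _; rewrite mulrA.
Qed.

(** The divergence of the projection to the tangent spaces of [f] times the
    [k]-th basis vector is [tder k f - n * x_k * f], the last term being the mean
    curvature of the sphere. *)
Lemma sphere_int_tder f k : smooth f ->
  sphere_int (tder k f) = n%:R * sphere_int (fun x => val x 0 k * f x).
Proof.
move=> sf; have [m nm] : exists m, n = m.+2 by exists n.-2; move: n1; case: (n) => [|[]].
have sx : smooth (fun x : sphere R n => val x 0 k * f x).
  by apply: smoothM => //; exact: smooth_coord.
apply/eqP; rewrite -subr_eq0 -mulNr -sphere_intZ// -sphere_intD; last first.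
- by apply: smoothM => //; exact: smooth_cst.
- exact: smooth_tder.
rewrite sphere_intE.
rewrite (@eq_Rintegral _ _ _ mu setT
  (fun t => \sum_i chart_field_der m i k f (row_of t))); last first.
  by move=> t _; rewrite (sum_chart_field_der _ _ nm sf) mulrC mulNr.
rewrite /Rintegral; under eq_integral do rewrite -sumEFin.
rewrite integral_sum//; last first.
  move=> i; have [C HC] := chart_field_der_le i k nm sf.
  by apply: (dominated_integrable _ HC); exact: continuous_chart_field_der.
by rewrite big1// => i _; exact: integral_chart_field_der.
Qed.

Lemma stereo_chart_surj (x : sphere R n) : val x 0 ord0 != 1 ->
  exists y, stereo_chart y = x.
Proof.
move=> x1; have x10 : 1 - val x 0 ord0 != 0 by rewrite subr_eq0 eq_sym.
pose y : 'rV[R]_n := \row_j (val x 0 (lift ord0 j) / (1 - val x 0 ord0)).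
have yy : dot y y = (1 + val x 0 ord0) / (1 - val x 0 ord0).
  have := dot_sphere x; rewrite /dot big_ord_recl => S.
  rewrite (eq_bigr (fun j => (val x 0 (lift ord0 j) * val x 0 (lift ord0 j))
    / (1 - val x 0 ord0) ^+ 2)); last first.
    by move=> j _; rewrite mxE; field.
  rewrite -mulr_suml.
  have -> : \sum_(j < n) val x 0 (lift ord0 j) * val x 0 (lift ord0 j) =
     1 - val x 0 ord0 * val x 0 ord0 by rewrite -[X in _ = X - _]S; ring.
  by field.
have ry : rho y = 1 - val x 0 ord0.
  rewrite /rho yy; field; rewrite x10 /=.
  by rewrite [X in X != 0](_ : _ = 2) ?pnatr_eq0//; ring.
exists y; apply/val_inj/rowP => k; rewrite /= -/(stereo y).
have [j ->|->] := unliftP ord0 k; last by rewrite stereo0 ry; ring.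
by rewrite stereoS ry mxE; field.
Qed.

(** The chart misses the pole only, which is a limit of points of the chart. *)
Lemma smooth_chart_eq0 f : smooth f -> (forall y, f (stereo_chart y) = 0) ->
  forall x, f x = 0.
Proof.
move=> sf f0 x; have [x1|/stereo_chart_surj[y <-]//] := eqVneq (val x 0 ord0) 1.
have xj j : val x 0 (lift ord0 j) = 0.
  have := dot_sphere x; rewrite /dot big_ord_recl x1 mulr1 => /eqP.
  rewrite -subr_eq0 addrAC subrr add0r psumr_eq0 => [/allP|i _]; last by rewrite -expr2 sqr_ge0.
  by move=> /(_ j (mem_index_enum _)) /=; rewrite mulf_eq0 orbb => /eqP.
have [U [F [oU Ux CF fF]]] := sf x.
have cF : {for val x, continuous F} by have [+ _] := CF 0%N; apply.
apply: contrapT => /eqP fx0.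
have : \forall z \near val x, U z /\ F z != 0.
  apply: filterI; first exact: open_nbhs_nbhs.
  have Fx : F (val x) != 0 by rewrite -fF.
  have nF : nbhs (F (val x)) [set a : R | a != 0].
    by apply: open_nbhs_nbhs; split => //; exact: open_neq.
  exact: (cF _ nF).
move=> /nbhs_ballP[e /= e0 He].
pose i0 : 'I_n := Ordinal (ltnW n1).
have [p pe] : exists p : nat, 2 / p.+1%:R < e.
  have e20 : 0 < e / 2 by rewrite divr_gt0.
  have [p _ /(_ p (leqnn p)) /= pe] := near_infty_natSinv_lt (PosNum e20).
  by exists p; rewrite mulrC -ltr_pdivlMr.
pose y : 'rV[R]_n := p.+1%:R *: basis_vec R i0.
have yy : dot y y = p.+1%:R ^+ 2.
  rewrite /dot (bigD1 i0)//= big1 ?addr0 => [|j /negbTE ji]; rewrite !mxE ?eqxx/=.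
    by ring.
  by rewrite ji mulr0 mul0r.
have p1 : 1 <= p.+1%:R :> R by rewrite ler1n.
have rp : rho y * p.+1%:R <= 2 / p.+1%:R.
  rewrite /rho yy ler_pdivlMr; last by lra.
  rewrite -!mulrA ler_piMr// mulrC ler_pdivrMr ?mul1r; nra.
have rp0 := rho_gt0 y.
have /He[Uz] : ball (val x) e (stereo y).
  split => // i k; rewrite (ord1 i) /ball/=.
  have [j ->|->] := unliftP ord0 k.
    rewrite xj stereoS sub0r normrN normrM (gtr0_norm rp0) (le_lt_trans _ pe)//.
    apply: le_trans rp; apply: ler_wpM2l; first exact: ltW.
    rewrite /y !mxE eqxx/=; case: eqP => _; rewrite ?mulr1 ?mulr0 ?normr0 ?normr_nat//.
  rewrite x1 stereo0 opprB addrC subrK (gtr0_norm rp0).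
  by apply: le_lt_trans pe; apply: le_trans rp; rewrite ler_peMr// ltW.
by rewrite -(fF (stereo_chart y))// f0 eqxx.
Qed.

Lemma sphere_int_sq (W : 'I_n.+1 -> sphere R n -> R) : (forall k, smooth (W k)) ->
  sphere_int (fun x => \sum_k W k x * W k x) = 0 -> forall k x, W k x = 0.
Proof.
move=> sW I0.
have sS : smooth (fun x => \sum_k W k x * W k x).
  elim: (index_enum _) => [|k r IHr].
    rewrite (_ : (fun x => _) = (fun=> 0)); first exact: smooth_cst.
    by apply/funext => x; rewrite big_nil.
  rewrite (_ : (fun x => _) = (fun x => W k x * W k x + \sum_(j <- r) W j x * W j x)).
    by apply: smoothD => //; exact: smoothM.
  by apply/funext => x; rewrite big_cons.
have S0 x : 0 <= \sum_k W k x * W k x by apply: sumr_ge0 => k _; rewrite -expr2 sqr_ge0.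
have H y : \sum_k W k (stereo_chart y) * W k (stereo_chart y) = 0.
  have := @integral_continuous_eq0 R n (fun y =>
    (\sum_k W k (stereo_chart y) * W k (stereo_chart y)) * rho y ^+ n).
  move=> /(_ _ _ _ y) H; have r0 : rho y ^+ n != 0 by rewrite expf_neq0// gt_eqF// rho_gt0.
  apply: (mulIf r0); rewrite mul0r; apply: H.
  - by apply: contM; [exact: (continuous_chart sS)|exact: continuous_rhoX].
  - by move=> z; rewrite mulr_ge0// exprn_ge0// ltW// rho_gt0.
  - move: I0; rewrite sphere_intE /Rintegral => I0.
    by rewrite -[LHS]fineK ?I0//; exact: integrable_fin_num (sphere_integrable sS).
move=> k; apply: smooth_chart_eq0 => // y.
have /eqP := H y; rewrite psumr_eq0 => [/allP|i _]; last by rewrite -expr2 sqr_ge0.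
by move=> /(_ k (mem_index_enum _)) /=; rewrite mulf_eq0 orbb => /eqP.
Qed.

End sphere_integral.

(** * The Laplacian and conformal fields in terms of tangential derivatives *)

(** The properties of smooth functions on the n-sphere behind the integral
    identities.  Over an abstract record, what remains to be proved are identities
    in a commutative ring with derivations. *)
Record sphere_calculus (R : realType) (n : nat) := SphereCalculus {
  sc_ring :> comPzRingType;
  sc_x : 'I_n.+1 -> sc_ring;
  sc_D : 'I_n.+1 -> sc_ring -> sc_ring;
  sc_cst : R -> sc_ring;
  sc_exp : sc_ring -> sc_ring;
  sc_int : sc_ring -> R;
  sc_derD : forall i f g, sc_D i (f + g) = sc_D i f + sc_D i g;
  sc_derM : forall i f g, sc_D i (f * g) = f * sc_D i g + g * sc_D i f;
  sc_der_cst : forall i c, sc_D i (sc_cst c) = 0;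
  sc_der_exp : forall i f, sc_D i (sc_exp f) = sc_exp f * sc_D i f;
  sc_der_x : forall i j, sc_D i (sc_x j) = (i == j)%:R - sc_x i * sc_x j;
  sc_sum_xx : \sum_i sc_x i * sc_x i = 1;
  sc_sum_xD : forall f, \sum_i sc_x i * sc_D i f = 0;
  sc_der_comm : forall i j f, sc_D i (sc_D j f) =
    sc_D j (sc_D i f) + sc_x i * sc_D j f - sc_x j * sc_D i f;
  sc_cstD : forall a b, sc_cst (a + b) = sc_cst a + sc_cst b;
  sc_cstM : forall a b, sc_cst (a * b) = sc_cst a * sc_cst b;
  sc_cst1 : sc_cst 1 = 1;
  sc_expD : forall f g, sc_exp (f + g) = sc_exp f * sc_exp g;
  sc_exp0 : sc_exp 0 = 1;
  sc_intD : forall f g, sc_int (f + g) = sc_int f + sc_int g;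
  sc_intZ : forall c f, sc_int (sc_cst c * f) = c * sc_int f;
  sc_int_div : forall W : 'I_n.+1 -> sc_ring,
    sc_int (\sum_i sc_D i (W i)) = n%:R * sc_int (\sum_i sc_x i * W i);
  sc_int_sq : forall W : 'I_n.+1 -> sc_ring,
    sc_int (\sum_i W i * W i) = 0 -> forall i, W i = 0
}.

Section conformal_calculus.
Context (R : realType) (n : nat) (A : sphere_calculus R n).
Local Notation I := 'I_n.+1.
Local Notation D := (@sc_D R n A).
Local Notation x := (@sc_x R n A).
Local Notation cst := (@sc_cst R n A).
Local Notation ex := (@sc_exp R n A).
Local Notation int := (@sc_int R n A).
Implicit Types (f g s : A) (i j : I) (X : I -> A).

Lemma sc_der0 i : D i 0 = 0.
Proof.
have : D i (0 + 0) - D i 0 = 0 by rewrite addr0 subrr.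
by rewrite sc_derD addrK.
Qed.

Lemma sc_derN i f : D i (- f) = - D i f.
Proof. by apply/eqP; rewrite -subr_eq0 opprK -sc_derD addNr sc_der0. Qed.

Lemma sc_derB i f g : D i (f - g) = D i f - D i g.
Proof. by rewrite sc_derD sc_derN. Qed.

Lemma sc_der_sum i (F : I -> A) : D i (\sum_j F j) = \sum_j D i (F j).
Proof. exact: (big_morph (D i) (sc_derD i) (sc_der0 i)). Qed.

Lemma sc_cst_nat k : cst k%:R = k%:R.
Proof.
elim: k => [|k IHk].
  by have := sc_cstD A 0 0; rewrite addr0 => /esym/eqP; rewrite -subr_eq0 addrK => /eqP.
by rewrite -natr1 sc_cstD sc_cst1 IHk natr1.
Qed.

Lemma sc_der_nat i k : D i k%:R = 0.
Proof. by rewrite -sc_cst_nat sc_der_cst. Qed.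

Lemma sc_cst_cancel (c : R) f : c != 0 -> cst c * f = 0 -> f = 0.
Proof.
move=> c0 cf; have : cst c^-1 * (cst c * f) = 0 by rewrite cf mulr0.
by rewrite mulrA -sc_cstM mulVf// sc_cst1 mul1r.
Qed.

Lemma half_inj f g : 2 * f = 2 * g -> f = g.
Proof.
move=> fg; apply/eqP; rewrite -subr_eq0; apply/eqP.
apply: (@sc_cst_cancel 2%:R); first by rewrite pnatr_eq0.
by rewrite sc_cst_nat mulrBr fg subrr.
Qed.

(** The Laplacian with the sign of the trace of the Hessian, opposite to that of
    the positive Laplacian. *)
Definition lapl f : A := \sum_i D i (D i f).

Lemma laplD f g : lapl (f + g) = lapl f + lapl g.
Proof. by rewrite /lapl -big_split/=; apply: eq_bigr => i _; rewrite !sc_derD. Qed.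

Lemma lapl0 : lapl 0 = 0.
Proof. by rewrite /lapl big1// => i _; rewrite !sc_der0. Qed.

Lemma laplM f g :
  lapl (f * g) = f * lapl g + g * lapl f + 2 * \sum_i D i f * D i g.
Proof.
rewrite /lapl !mulr_sumr -!big_split/=; apply: eq_bigr => i _.
by rewrite sc_derM sc_derD !sc_derM; ring.
Qed.

Lemma lapl_cM (c : R) f : lapl (cst c * f) = cst c * lapl f.
Proof.
rewrite /lapl mulr_sumr; apply: eq_bigr => i _.
by rewrite sc_derM sc_der_cst mulr0 addr0 sc_derM sc_der_cst mulr0 addr0.
Qed.

Lemma sum_Dx : \sum_i D i (x i) = n%:R.
Proof.
rewrite (eq_bigr (fun i => 1 - x i * x i)) => [|i _]; last by rewrite sc_der_x eqxx.
by rewrite sumrB sc_sum_xx sumr_const card_ord -addn1 natrD addrK.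
Qed.

Lemma tangent_D X j : \sum_i x i * X i = 0 -> \sum_i x i * D j (X i) = - X j.
Proof.
move=> xX; have := sc_der_sum j (fun i => x i * X i); rewrite xX sc_der0.
rewrite (eq_bigr (fun i => x i * D j (X i) + (i == j)%:R * X i - x j * (x i * X i))).
  by rewrite sumrB big_split/= sum_delta -mulr_sumr xX mulr0 subr0 => /esym/eqP;
    rewrite addr_eq0 => /eqP.
by move=> i _; rewrite sc_derM sc_der_x (eq_sym j i); ring.
Qed.

Lemma sum_xDD j f : \sum_i x i * D j (D i f) = - D j f.
Proof. exact: (@tangent_D (fun i => D i f) j (sc_sum_xD f)). Qed.

Lemma laplx j : lapl (x j) = - n%:R * x j.
Proof.
rewrite /lapl (eq_bigr (fun i => - (x i * D i (x j)) - x j * D i (x i))); last first.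
  by move=> i _; rewrite [in LHS]sc_der_x sc_derB sc_der_nat sc_derM; ring.
by rewrite sumrB sumrN sc_sum_xD -mulr_sumr sum_Dx; ring.
Qed.

Lemma lapl_D j f :
  lapl (D j f) = D j (lapl f) + (n%:R - 2) * D j f - 2 * x j * lapl f.
Proof.
rewrite {1}/lapl (eq_bigr (fun i => D j (D i (D i f)) + x i * D j (D i f)
   + x i * D i (D j f) + D j f * D i (x i) + - (2 * x j) * D i (D i f)
   - (i == j)%:R * D i f + x j * (x i * D i f))); last first.
  move=> i _; rewrite (sc_der_comm i j f) sc_derB sc_derD !sc_derM (sc_der_comm i j (D i f)).
  by rewrite (sc_der_comm i j f) !sc_der_x; ring.
rewrite !(big_split, sumrN)/= sum_delta -!mulr_sumr sum_Dx.
rewrite (sc_sum_xD (D j f)) (sc_sum_xD f) sum_xDD -sc_der_sum -!/(lapl f); ring.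
Qed.

Definition act X f : A := \sum_j X j * D j f.

Lemma actD X f g : act X (f + g) = act X f + act X g.
Proof. by rewrite /act -big_split; apply: eq_bigr => i _; rewrite sc_derD mulrDr. Qed.

Lemma actM X f g : act X (f * g) = f * act X g + g * act X f.
Proof.
rewrite /act !mulr_sumr -big_split; apply: eq_bigr => i _; rewrite sc_derM /=; ring.
Qed.

Lemma act0 X : act X 0 = 0.
Proof. by rewrite /act big1// => i _; rewrite sc_der0 mulr0. Qed.

Lemma act_c X (c : R) : act X (cst c) = 0.
Proof. by rewrite /act big1// => i _; rewrite sc_der_cst mulr0. Qed.

(** The coordinates of the tangential projections of the basis vectors. *)
Definition proj i j : A := (i == j)%:R - x i * x j.

Lemma sum_proj i (F : I -> A) :
  \sum_j proj i j * F j = F i - x i * \sum_j x j * F j.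
Proof.
rewrite mulr_sumr -[F i](sum_delta i) -sumrB; apply: eq_bigr => j _.
by rewrite /proj (eq_sym i); ring.
Qed.

Lemma act_proj i f : act (proj i) f = D i f.
Proof. by rewrite /act sum_proj sc_sum_xD mulr0 subr0. Qed.

Lemma sum_x_proj i : \sum_j x j * proj i j = 0.
Proof.
by under eq_bigr do rewrite mulrC; rewrite sum_proj sc_sum_xx mulr1 subrr.
Qed.

Lemma sum_projM i j : \sum_k proj i k * proj j k = proj i j.
Proof. by rewrite sum_proj sum_x_proj mulr0 subr0 /proj eq_sym mulrC. Qed.

(** The Lie derivative along [X] of the metric. *)
Definition lie_form X (Y Z : I -> A) : A := act X (\sum_k Y k * Z k)
  - \sum_k (act X (Y k) - act Y (X k)) * Z k
  - \sum_k Y k * (act X (Z k) - act Z (X k)).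

Lemma lie_form_proj X i j : \sum_k x k * X k = 0 ->
  lie_form X (proj i) (proj j) = D i (X j) + D j (X i) + x j * X i + x i * X j.
Proof.
move=> xX; rewrite /lie_form (big_morph (act X) (actD X) (act0 X)).
transitivity (\sum_k proj j k * D i (X k) + \sum_k proj i k * D j (X k)).
  rewrite -big_split -!sumrB; apply: eq_bigr => k _.
  by rewrite actM !act_proj /=; ring.
by rewrite !sum_proj !tangent_D//; ring.
Qed.

(** The conformal Killing equation with factor [2 * s], written for the
    projections of the basis vectors. *)
Definition conformal X s := \sum_i x i * X i = 0 /\ forall i j,
  D i (X j) + D j (X i) + x j * X i + x i * X j =
  2 * s * ((i == j)%:R - x i * x j).

Lemma conformal_div X s : conformal X s -> \sum_i D i (X i) = n%:R * s.
Proof.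
move=> [xX K]; apply: half_inj.
transitivity (\sum_i (2 * s - 2 * s * (x i * x i) - 2 * (x i * X i))).
  rewrite mulr_sumr; apply: eq_bigr => i _.
  have := K i i; rewrite eqxx mulr1n => Ki.
  transitivity (D i (X i) + D i (X i) + x i * X i + x i * X i - 2 * (x i * X i)).
    by ring.
  by rewrite Ki; ring.
rewrite !sumrB -!mulr_sumr sc_sum_xx xX sumr_const card_ord -(mulr_natr s).
by rewrite -addn1 natrD; ring.
Qed.

(** The divergence of the conformal Killing equation, up to commutation of the
    derivatives. *)
Lemma conformal_lapl X s j : conformal X s ->
  lapl (X j) = - (n%:R - 2) * D j s - n%:R * X j - 2 * n%:R * s * x j.
Proof.
move=> cX; have [xX K] := cX.
rewrite /lapl (eq_bigr (fun i => 2 * ((i == j)%:R * D i s) - 2 * x j * (x i * D i s)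
  - 2 * s * ((i == j)%:R * x i) + 2 * s * x j * (x i * x i)
  - 2 * s * x j * D i (x i)
  - D j (D i (X i)) - x i * D j (X i) - (i == j)%:R * X i
  + x j * (x i * X i) - x i * D i (X j) - X j * D i (x i))); last first.
  move=> i _.
  have -> : D i (X j) = 2 * s * ((i == j)%:R - x i * x j)
      - D j (X i) - x j * X i - x i * X j by rewrite -K; ring.
  rewrite !(sc_derB, sc_derM, sc_der_nat) (sc_der_comm i j (X i)) !sc_der_x eqxx.
  have -> : D i (X j) = 2 * s * ((i == j)%:R - x i * x j)
      - D j (X i) - x j * X i - x i * X j by rewrite -K; ring.
  by ring.
rewrite !(big_split, sumrN)/= -!mulr_sumr !sum_delta (sc_sum_xD s) (sc_sum_xD (X j)) sum_Dx sc_sum_xx xX.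
rewrite -sc_der_sum (conformal_div cX) tangent_D// sc_derM sc_der_nat.
by ring.
Qed.

Hypothesis n1 : (1 < n)%N.

(** Taking the divergence of [conformal_lapl] determines the Laplacian of the
    conformal factor. *)
Lemma conformal_lapl_factor X s : conformal X s -> lapl s = - n%:R * s.
Proof.
move=> cX; have [xX K] := cX.
have E : \sum_j D j (lapl (X j)) = - (n%:R - 2) * lapl s - n%:R * (n%:R * s)
    - 2 * n%:R * (n%:R * s).
  rewrite (eq_bigr (fun j => - (n%:R - 2) * D j (D j s) - n%:R * D j (X j)
    - 2 * n%:R * (s * D j (x j)) - 2 * n%:R * (x j * D j s))).
    rewrite !(big_split, sumrN)/= -!mulr_sumr (conformal_div cX) sum_Dx (sc_sum_xD s).
    by rewrite -/(lapl s); ring.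
  move=> j _; rewrite (conformal_lapl j cX).
  by rewrite !(sc_derB, sc_derM, sc_der_nat, sc_derN); ring.
have F : \sum_j D j (lapl (X j)) = n%:R * lapl s - (n%:R - 2) * (n%:R * s)
   - 4 * n%:R * s.
  rewrite (eq_bigr (fun j => lapl (D j (X j)) - (n%:R - 2) * D j (X j)
     + 2 * (x j * lapl (X j)))); last by move=> j _; rewrite lapl_D; ring.
  rewrite !(big_split, sumrN)/= -!mulr_sumr (conformal_div cX).
  rewrite -(big_morph lapl laplD lapl0) (conformal_div cX) -sc_cst_nat lapl_cM sc_cst_nat.
  rewrite (eq_bigr (fun j => - (n%:R - 2) * (x j * D j s) - n%:R * (x j * X j)
     - 2 * n%:R * s * (x j * x j))); last first.
    by move=> j _; rewrite (conformal_lapl j cX); ring.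
  by rewrite !(big_split, sumrN)/= -!mulr_sumr (sc_sum_xD s) xX sc_sum_xx; ring.
apply/eqP; rewrite mulNr -subr_eq0 opprK; apply/eqP.
apply: (@sc_cst_cancel (2%:R * n.-1%:R)); first by rewrite mulf_neq0 ?pnatr_eq0; case: n n1 => [|[]].
rewrite sc_cstM !sc_cst_nat; move: E; rewrite F => /eqP; rewrite -subr_eq0 => /eqP <-.
by rewrite -subn1 natrB 1?ltnW//; ring.
Qed.

(** The commutator with [X] is the first variation of the Laplacian under the
    conformal change of metric that the flow of [X] induces. *)
Lemma lapl_act X s f : conformal X s ->
  lapl (act X f) = act X (lapl f) + 2 * s * lapl f
    - (n%:R - 2) * act (D^~ s) f.
Proof.
move=> cX; have [xX K] := cX.
have B : \sum_j \sum_i D i (X j) * D i (D j f) = s * lapl f + act X f.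
  apply: half_inj.
  transitivity (\sum_j \sum_i (D i (X j) * D i (D j f) + D j (X i) * D j (D i f))).
    rewrite mulr_natl mulr2n {2}exchange_big -big_split/=.
    by apply: eq_bigr => j _; rewrite -big_split.
  transitivity (\sum_j (2 * s * D j (D j f) - 2 * s * x j * (\sum_i x i * D i (D j f))
     - \sum_i X i * (x j * D i (D j f)) - X j * (\sum_i x i * D i (D j f))
     - D j f * (\sum_i x i * D j (X i)) + \sum_i D i f * (x j * D j (X i)))).
    apply: eq_bigr => j _.
    rewrite -(sum_delta j (fun i => D i (D j f))) !mulr_sumr -!sumrB -big_split/=.
    apply: eq_bigr => i _; rewrite (sc_der_comm j i f).
    have -> : D i (X j) = 2 * s * ((i == j)%:R - x i * x j)
       - D j (X i) - x j * X i - x i * X j by rewrite -K; ring.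
    by ring.
  have T2 : \sum_j 2 * s * x j * (\sum_i x i * D i (D j f)) = 0.
    by rewrite big1// => j _; rewrite (sc_sum_xD (D j f)) mulr0.
  have T3 : \sum_j \sum_i X i * (x j * D i (D j f)) = - act X f.
    rewrite exchange_big -sumrN; apply: eq_bigr => i _.
    by rewrite -mulr_sumr sum_xDD mulrN.
  have T4 : \sum_j X j * (\sum_i x i * D i (D j f)) = 0.
    by rewrite big1// => j _; rewrite (sc_sum_xD (D j f)) mulr0.
  have T5 : \sum_j D j f * (\sum_i x i * D j (X i)) = - act X f.
    rewrite -sumrN; apply: eq_bigr => j _.
    by rewrite (tangent_D _ xX) mulrN mulrC.
  have T6 : \sum_j \sum_i D i f * (x j * D j (X i)) = 0.
    rewrite exchange_big big1//= => i _.
    by rewrite -mulr_sumr (sc_sum_xD (X i)) mulr0.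
  rewrite big_split/= !sumrB T2 T3 T4 T5 T6 -mulr_sumr -/(lapl f); ring.
rewrite {1}/act (big_morph lapl laplD lapl0).
rewrite (eq_bigr (fun j => X j * D j (lapl f) + (n%:R - 2) * (X j * D j f)
   - 2 * lapl f * (x j * X j) - (n%:R - 2) * (D j s * D j f) - n%:R * (X j * D j f)
   - 2 * n%:R * s * (x j * D j f) + 2 * \sum_i D i (X j) * D i (D j f))); last first.
  by move=> j _; rewrite laplM lapl_D (conformal_lapl j cX); ring.
rewrite !(big_split, sumrN)/= -!mulr_sumr B xX (sc_sum_xD f) -!/(act _ _).
ring.
Qed.

(** * First spherical harmonics *)

Lemma sum_DxD i f : \sum_k D k (x i) * D k f = D i f.
Proof.
rewrite (eq_bigr (fun k => (k == i)%:R * D k f - x i * (x k * D k f))).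
  by rewrite sumrB sum_delta -mulr_sumr sc_sum_xD mulr0 subr0.
by move=> k _; rewrite sc_der_x; ring.
Qed.

Lemma sc_int0 : int (0 : A) = 0.
Proof. by apply: (addrI (int (0 : A))); rewrite -sc_intD !addr0. Qed.

Lemma sc_intN f : int (- f) = - int f.
Proof. by apply/eqP; rewrite -subr_eq0 opprK -sc_intD addNr sc_int0. Qed.

Lemma int_divergence X : \sum_i x i * X i = 0 -> int (\sum_i D i (X i)) = 0.
Proof. by rewrite sc_int_div => ->; rewrite sc_int0 mulr0. Qed.

(** The integral of the squared gradient of [f] is that of [- f * lapl f]. *)
Lemma harmonic_const f : lapl f = 0 -> forall i, D i f = 0.
Proof.
move=> Lf; apply: sc_int_sq.
rewrite -[RHS](@int_divergence (fun i => f * D i f)).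
  congr int; transitivity (f * lapl f + \sum_i D i f * D i f).
    by rewrite Lf mulr0 add0r.
  rewrite /lapl mulr_sumr -big_split.
  by apply: eq_bigr => i _; rewrite sc_derM /=; ring.
rewrite (eq_bigr (fun i => f * (x i * D i f))); last by move=> i _; ring.
by rewrite -mulr_sumr sc_sum_xD mulr0.
Qed.

(** For an eigenfunction [z] the functions [D i z + x i * z] are harmonic: they
    are the partial derivatives of the extension of [z] that is homogeneous of
    degree 1.  So they are constant, which says that the Hessian of [z] is [- z]
    times the metric. *)
Lemma eigen_hessian z i j : lapl z = - n%:R * z ->
  D i (D j z) = - x j * D i z - ((i == j)%:R - x i * x j) * z.
Proof.
move=> Lz.
have : lapl (D j z + x j * z) = 0.
  rewrite laplD lapl_D laplM sum_DxD laplx Lz sc_derM sc_derN sc_der_nat.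
  by ring.
move=> /harmonic_const /(_ i); rewrite sc_derD sc_derM sc_der_x => /eqP.
by rewrite addr_eq0 => /eqP ->; ring.
Qed.

Lemma eigen_conformal z : lapl z = - n%:R * z -> conformal (D^~ z) (- z).
Proof.
move=> Lz; split; first exact: sc_sum_xD.
by move=> i j; rewrite !(eigen_hessian _ _ Lz) (eq_sym j i); ring.
Qed.

(** * Conformal covariance of the Paneitz-Branson operators *)

Lemma sc_cstN a : cst (- a) = - cst a.
Proof.
by apply/eqP; rewrite -addr_eq0 -sc_cstD addNr (sc_cst_nat 0).
Qed.

Local Notation nu := (n%:R / 2 : R).

Lemma double_nu : n%:R = 2 * cst nu.
Proof. by rewrite -(sc_cst_nat 2) -sc_cstM -sc_cst_nat; congr cst; field. Qed.

Fixpoint pan m f : A :=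
  if m is k.+1 then
    - lapl (pan k f) + cst ((nu - m%:R) * (nu + m%:R - 1)) * pan k f
  else f.

Lemma panS m f : pan m.+1 f = - lapl (pan m f)
  + (cst nu - m.+1%:R) * (cst nu + m.+1%:R - 1) * pan m f.
Proof. by rewrite /= sc_cstM !sc_cstD !sc_cstN sc_cst_nat sc_cst1. Qed.

Lemma laplN f : lapl (- f) = - lapl f.
Proof. by rewrite /lapl -sumrN; apply: eq_bigr => i _; rewrite !sc_derN. Qed.

Lemma panB m f g : pan m (f - g) = pan m f - pan m g.
Proof. by elim: m => [//|m IHm]; rewrite !panS IHm laplD laplN; ring. Qed.

Lemma lapl_const (c : A) f : (forall i, D i c = 0) -> lapl (c * f) = c * lapl f.
Proof.
move=> Dc; rewrite laplM (_ : lapl c = 0) ?mulr0 ?addr0.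
  by rewrite big1 ?mulr0 ?addr0// => i _; rewrite Dc mul0r.
by rewrite /lapl big1// => i _; rewrite Dc sc_der0.
Qed.

Lemma act_const X (c : A) f : (forall i, D i c = 0) -> act X (c * f) = c * act X f.
Proof.
move=> Dc; rewrite actM (_ : act X c = 0) ?mulr0 ?addr0//.
by rewrite /act big1// => i _; rewrite Dc mulr0.
Qed.

Lemma actN X f : act X (- f) = - act X f.
Proof. by rewrite /act -sumrN; apply: eq_bigr => i _; rewrite sc_derN mulrN. Qed.

Lemma pan_cst m (c : R) : exists d : R, pan m (cst c) = cst d.
Proof.
elim: m c => [|m IHm] c; first by exists c.
have [d pd] := IHm c; exists ((nu - m.+1%:R) * (nu + m.+1%:R - 1) * d).
rewrite /= pd [RHS]sc_cstM (_ : lapl (cst d) = 0) ?oppr0 ?add0r//.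
by rewrite /lapl big1// => i _; rewrite sc_der_cst sc_der0.
Qed.

Section factor.
Context (s : A).
Hypothesis Ls : lapl s = - n%:R * s.

Lemma lapl_factor f :
  lapl (s * f) = s * lapl f - n%:R * s * f + 2 * act (D^~ s) f.
Proof. by rewrite laplM Ls /act; ring. Qed.

Lemma lapl_grad f : lapl (act (D^~ s) f) =
  act (D^~ s) (lapl f) - 2 * s * lapl f + (n%:R - 2) * act (D^~ s) f.
Proof.
rewrite (lapl_act _ (eigen_conformal Ls)).
have -> : act (D^~ (- s)) f = - act (D^~ s) f.
  by rewrite /act -sumrN; apply: eq_bigr => i _; rewrite sc_derN mulNr.
by ring.
Qed.

(** On spherical harmonics of degree [l], multiplication by the first harmonic
    [s] lands in degrees [l + 1] and [l - 1]; comparing the eigenvalues of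
    [pan m.+1] there with that of [pan m] in degree [l] gives this second order
    operator. *)
Definition shift_op m f : A :=
  s * (- lapl f + (cst nu + m%:R) * (cst nu + m%:R - 1) * f)
  - 2 * m%:R * act (D^~ s) f.

Lemma pan_factor m f : pan m.+1 (s * f) = shift_op m.+1 (pan m f).
Proof.
elim: m => [|m IHm].
  by rewrite panS /= lapl_factor /shift_op double_nu; ring.
rewrite panS IHm; set h := pan m f.
have Dp k i : D i ((cst nu + k%:R) * (cst nu + k%:R - 1)) = 0.
  by rewrite sc_derM !sc_derD !sc_derN !sc_der_nat sc_der_cst (sc_der_nat i 1); ring.
have Dm k i : D i ((cst nu - k%:R) * (cst nu + k%:R - 1)) = 0.
  by rewrite sc_derM !sc_derD !sc_derN !sc_der_nat sc_der_cst (sc_der_nat i 1); ring.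
have lp k f' := lapl_const f' (Dp k).
have lm k f' := lapl_const f' (Dm k).
have ap k f' := act_const (D^~ s) f' (Dp k).
have am k f' := act_const (D^~ s) f' (Dm k).
have l2 k f' : lapl (2 * k%:R * f') = 2 * k%:R * lapl f'.
  by apply: lapl_const => i; rewrite sc_derM !sc_der_nat; ring.
rewrite {1}/shift_op laplD laplN l2 lapl_grad lapl_factor laplD laplN lp.
rewrite [in RHS]panS -/h /shift_op !laplD !laplN lm !actD !actN ap am.
rewrite double_nu -[m.+2%:R]natr1 -[m.+1%:R]natr1; ring.
Qed.

End factor.

(** Infinitesimal conformal covariance: [pan m] intertwines the actions of [X] on
    densities of weights [nu - m] and [nu + m].  From [m] to [m.+1] the first
    weight drops by one, which subtracts [s * f], and [pan_factor] expresses
    [pan m.+1 (s * f)] through [pan m f]; as [pan m.+1] is a second order operator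
    applied after [pan m], only the commutator [lapl_act] remains. *)
Lemma pan_covariant m X s f : conformal X s ->
  pan m (act X f + cst (nu - m%:R) * s * f) =
  act X (pan m f) + cst (nu + m%:R) * s * pan m f.
Proof.
move=> cX; have Ls := conformal_lapl_factor cX.
elim: m => [|m IHm]; first by rewrite /= subr0 addr0.
have -> : act X f + cst (nu - m.+1%:R) * s * f =
    act X f + cst (nu - m%:R) * s * f - s * f.
  by rewrite !(sc_cstD, sc_cstN, sc_cst_nat) -natr1; ring.
rewrite panB (pan_factor Ls) panS IHm; set h := pan m f.
have lc (c : R) f' : lapl (cst c * s * f') = cst c * lapl (s * f').
  by rewrite -mulrA lapl_cM.
have ac k f' : act X ((cst nu - k%:R) * (cst nu + k%:R - 1) * f') =
    (cst nu - k%:R) * (cst nu + k%:R - 1) * act X f'.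
  apply: act_const => i.
  by rewrite sc_derM !sc_derD !sc_derN !sc_der_nat sc_der_cst (sc_der_nat i 1); ring.
rewrite laplD (lapl_act _ cX) lc (lapl_factor Ls) [in RHS]panS -/h actD actN ac.
rewrite /shift_op !(sc_cstD, sc_cstN, sc_cst_nat) double_nu -[m.+1%:R]natr1; ring.
Qed.

(** * The integral identities *)

Lemma int_act X s f g : conformal X s ->
  int (act X f * g) = - int (f * act X g) - n%:R * int (s * f * g).
Proof.
move=> cX; have [xX _] := cX.
have /int_divergence : \sum_i x i * (X i * f * g) = 0.
  rewrite (eq_bigr (fun i => x i * X i * (f * g))); last by move=> i _; ring.
  by rewrite -mulr_suml xX mul0r.
have -> : \sum_i D i (X i * f * g) = act X f * g + f * act X g + n%:R * (s * f * g).
  transitivity ((\sum_i D i (X i)) * (f * g) + act X f * g + f * act X g).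
    rewrite /act mulr_sumr !mulr_suml -!big_split; apply: eq_bigr => i _ /=.
    by rewrite !sc_derM; ring.
  by rewrite (conformal_div cX); ring.
rewrite !sc_intD -sc_cst_nat sc_intZ => /eqP; rewrite addr_eq0 addrC => /eqP H.
by rewrite -H; ring.
Qed.

Lemma int_lapl f g : int (f * lapl g) = int (lapl f * g).
Proof.
apply/eqP; rewrite -subr_eq0 -sc_intN -sc_intD; apply/eqP.
rewrite -[RHS](@int_divergence (fun i => f * D i g - g * D i f)).
  congr int; rewrite /lapl mulr_sumr mulr_suml -sumrB; apply: eq_bigr => i _.
  by rewrite sc_derB !sc_derM; ring.
rewrite (eq_bigr (fun i => f * (x i * D i g) - g * (x i * D i f))).
  by rewrite sumrB -!mulr_sumr !sc_sum_xD !mulr0 subr0.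
by move=> i _; ring.
Qed.

Lemma pan_lapl m f : pan m (lapl f) = lapl (pan m f).
Proof. by elim: m => [//|m IHm]; rewrite /= IHm laplD laplN lapl_cM. Qed.

Lemma int_pan m f g : int (f * pan m g) = int (pan m f * g).
Proof.
elim: m f g => [//|m IHm] f g; rewrite /=; set c := cst _.
rewrite mulrDr mulrN sc_intD sc_intN int_lapl IHm pan_lapl mulrCA sc_intZ IHm -sc_intZ.
by rewrite mulrA -sc_intN -sc_intD -mulNr -mulrDl.
Qed.

(** The actions of [X] on the weights [nu - m] and [nu + m] are opposite adjoints
    for the integral, so [pan m], which is symmetric and intertwines them, turns
    the left-hand side into its opposite. *)
Lemma int_covariant m X s w : conformal X s ->
  int ((act X w + cst (nu - m%:R) * s * w) * pan m w) = 0.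
Proof.
move=> cX; set T := act X w + _.
have skew : int (T * pan m w) = - int (T * pan m w).
  rewrite {1}int_pan (pan_covariant _ _ cX) mulrDl sc_intD (int_act _ _ cX).
  rewrite -sc_intN -(sc_intZ n%:R) -sc_intN -!sc_intD sc_cst_nat -sc_intN; congr int.
  by rewrite /T !(sc_cstD, sc_cstN, sc_cst_nat) double_nu; ring.
by move: skew; set t := int _ => skew; lra.
Qed.

Lemma act_ex X f : act X (ex f) = ex f * act X f.
Proof.
by rewrite /act mulr_sumr; apply: eq_bigr => i _; rewrite sc_der_exp; ring.
Qed.

Lemma act_cM X c f : act X (cst c * f) = cst c * act X f.
Proof. by rewrite actM act_c mulr0 addr0. Qed.

(** The integrand is a combination of [act X (pan m w) * w] and
    [act X w * pan m w], where [w] is the exponential of [(nu - m) * u]; moving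
    [X] off [pan m w] makes it a multiple of that of [int_covariant]. *)
Lemma int_Q_noncritical m X s u : conformal X s -> nu - m%:R != 0 ->
  int (act X (ex (cst (- (nu + m%:R)) * u) * pan m (ex (cst (nu - m%:R) * u)))
    * ex (cst n%:R * u)) = 0.
Proof.
move=> cX a0; set a := nu - m%:R; set b := nu + m%:R.
set w := ex (cst a * u); set e := ex (cst (- b) * u).
have ewn : e * ex (cst n%:R * u) = w.
  rewrite -sc_expD -mulrDl -sc_cstD; congr (ex (cst _ * u)).
  by rewrite /a /b; field.
apply: (mulfI a0); rewrite mulr0 -sc_intZ.
have -> : cst a * (act X (e * pan m w) * ex (cst n%:R * u)) =
    cst a * (act X (pan m w) * w) - cst b * (act X w * pan m w).
  have -> : act X w = w * (cst a * act X u) by rewrite /w act_ex act_cM.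
  rewrite actM {2}/e act_ex act_cM -/e sc_cstN; set p := pan m w.
  by clearbody p; rewrite -ewn; ring.
have := int_covariant m w cX; rewrite -/a mulrDl sc_intD -!mulrA sc_intZ => C.
rewrite sc_intD sc_intN !sc_intZ (int_act _ _ cX) [pan m w * act X w]mulrC.
rewrite -(mulrA s) [pan m w * w]mulrC.
have -> : n%:R = a + b by rewrite /a /b; field.
rewrite -[RHS](mulr0 (- (a + b))) -C; ring.
Qed.

(** The eigenvalues are ratios of factorials: passing from [k] to [k.+1]
    multiplies by [(m + k + 1) * (m - k)]. *)
Lemma pan_eigen k m s : lapl s = - n%:R * s -> n = m.*2 -> (k <= m)%N ->
  exists2 c : R, pan k s = cst c * s & c * (m - k)`!%:R = (m + k)`!%:R.
Proof.
move=> Ls nm; elim: k => [|k IHk] km.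
  by exists 1; rewrite ?sc_cst1 ?mul1r// subn0 addn0.
have [c pk ck] := IHk (ltnW km).
exists (c * (n%:R + (nu - k.+1%:R) * (nu + k.+1%:R - 1))).
  rewrite panS pk lapl_cM Ls sc_cstM sc_cstD sc_cstM !(sc_cstD, sc_cstN, sc_cst_nat, sc_cst1).
  by ring.
have -> : n%:R = 2 * m%:R :> R by rewrite nm -muln2 natrM mulrC.
rewrite addnS factS natrM -ck -(subnSK km) factS natrM subnSK//.
by rewrite (natrB _ (ltnW km)); field.
Qed.

(** In the critical dimension [n = 2 * m] the covariance holds at weight 0.  There
    remain the integrals of [s * pan m u] and of [act X u] times the constant
    curvature [(n - 1)!]; they cancel since the conformal factor [s] is a first
    harmonic, on which [pan m] is multiplication by [n!]. *)
Lemma int_Q_critical m X s u : conformal X s -> n = m.*2 -> (0 < m)%N ->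
  int (act X (ex (cst (- n%:R) * u) * (cst (m.*2.-1)`!%:R + pan m u))
    * ex (cst n%:R * u)) = 0.
Proof.
move=> cX nm m0; rewrite (_ : m.*2.-1 = m.-1.*2.+1); last by rewrite -{1}(prednK m0) doubleS.
set q := (_`!)%:R; set e := ex (cst (- n%:R) * u).
have een : e * ex (cst n%:R * u) = 1.
  by rewrite -sc_expD -mulrDl -sc_cstD addNr (sc_cst_nat 0) mul0r sc_exp0.
have -> : act X (e * (cst q + pan m u)) * ex (cst n%:R * u) =
    act X (pan m u) * 1 - cst n%:R * (act X u * pan m u)
    - cst (n%:R * q) * (act X u * 1).
  rewrite actM actD act_c {2}/e act_ex act_cM -/e.
  transitivity (e * ex (cst n%:R * u) * (act X (pan m u)
    + (cst q + pan m u) * (cst (- n%:R) * act X u))); first by ring.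
  by rewrite een sc_cstN sc_cstM; ring.
have nu_m : nu - m%:R = 0 by rewrite nm -muln2 natrM; field.
have := int_covariant m u cX; rewrite nu_m (sc_cst_nat 0) !mul0r addr0 => Tu.
rewrite !sc_intD !sc_intN !sc_intZ Tu !(int_act _ _ cX) -sc_cst1 act_c sc_cst1 !mulr0 !mulr1 sc_int0.
have [c ps] := pan_eigen (conformal_lapl_factor cX) nm (leqnn m).
rewrite subnn mulr1 addnn => cE.
rewrite int_pan ps -mulrA sc_intZ cE -(prednK m0) doubleS factS natrM -doubleS prednK//.
by rewrite -nm /q; ring.
Qed.

Lemma eigen_act_zero z e : lapl z = - n%:R * z ->
  int (act (D^~ z) z * (e * e)) = 0 -> forall i, e * D i z = 0.
Proof.
move=> Lz I0; apply: sc_int_sq; rewrite -[RHS]I0; congr int.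
by rewrite /act mulr_suml; apply: eq_bigr => i _; ring.
Qed.

End conformal_calculus.

(** * The Kazdan-Warner identity for the Q-curvature *)

Section kazdan_warner.
Context (R : realType) (n : nat) (n1 : (1 < n)%N).

Lemma sfun_exp0 : sfun_exp (0 : sfun R n) = 1.
Proof. by apply: sfun_ext => x; exact: expR0. Qed.

Lemma sfun_cst1 : sfun_cst n 1 = 1 :> sfun R n.
Proof. exact: sfun_ext. Qed.

Lemma sfun_intD (f g : sfun R n) :
  sphere_int (f + g : sfun R n) = sphere_int f + sphere_int g.
Proof. exact: (sphere_intD n1 (sfunP f) (sfunP g)). Qed.

Lemma sfun_intZ (c : R) (f : sfun R n) :
  sphere_int (sfun_cst n c * f : sfun R n) = c * sphere_int f.
Proof. exact: (sphere_intZ n1 c (sfunP f)). Qed.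

Lemma sfun_int_div (W : 'I_n.+1 -> sfun R n) :
  sphere_int (\sum_i sfun_der i (W i)) =
  n%:R * sphere_int (\sum_i sfun_x R i * W i).
Proof.
elim: (index_enum _) => [|k r IHr].
  rewrite !big_nil (_ : (0 : sfun R n) = sfun_cst n 0 * 0); last by rewrite mulr0.
  by rewrite sfun_intZ mul0r mulr0.
rewrite !big_cons !sfun_intD mulrDr IHr; congr (_ + _).
exact: (sphere_int_tder n1 k (sfunP (W k))).
Qed.

Lemma sfun_int_sq (W : 'I_n.+1 -> sfun R n) :
  sphere_int (\sum_i W i * W i) = 0 -> forall i, W i = 0.
Proof.
move=> I0 i; apply: sfun_ext => x.
apply: (@sphere_int_sq _ _ n1 W (fun k => sfunP (W k))); rewrite -[RHS]I0.
by congr sphere_int; apply/funext => z; rewrite sum_sfunE.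
Qed.

Definition smooth_calculus : sphere_calculus R n := SphereCalculus
  (@sfun_derD R n) (@sfun_derM R n) (@sfun_der_cst R n) (@sfun_der_exp R n)
  (@sfun_der_x R n) (@sfun_sum_xx R n) (@sfun_sum_xD R n) (@sfun_der_comm R n)
  (@sfun_cstD R n) (@sfun_cstM R n) sfun_cst1 (@sfun_expD R n) sfun_exp0
  sfun_intD sfun_intZ sfun_int_div sfun_int_sq.

Local Notation A := smooth_calculus.
Local Notation cst := (@sc_cst R n A).
Local Notation ex := (@sc_exp R n A).
Local Notation int := (@sc_int R n A).
Local Notation fn f := (@sfun_val R n f).

(** The correction that [cov_deriv] subtracts from the ambient derivative of the
    gradient is normal to the sphere, so it has no trace on the tangent spaces. *)
Lemma laplacianE (f : A) : laplacian (fn f) = fn (- lapl f).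
Proof.
apply/funext => x; rewrite /laplacian /sdiv [RHS]/(- fn (lapl f) x); congr (- _).
rewrite /lapl sum_sfunE.
have S k : (fun y => sgrad (fn f) y 0 k) = tder k (fn f).
  by apply/funext => y; rewrite /sgrad mxE.
have E i k : vec_diff (sgrad (fn f)) x (tan_proj x (basis_vec R i)) 0 k =
    tder i (tder k (fn f)) x.
  by rewrite /vec_diff mxE S.
have T v i : tan_proj x v 0 i = v 0 i - val x 0 i * (\sum_k v 0 k * val x 0 k).
  by rewrite /tan_proj !mxE mulrC.
rewrite (eq_bigr (fun i => tder i (tder i (fn f)) x
   - val x 0 i * (\sum_k tder i (tder k (fn f)) x * val x 0 k))); last first.
  move=> i _; rewrite /cov_deriv T E; congr (_ - _ * _).
  by apply: eq_bigr => k _; rewrite E.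
rewrite sumrB [X in _ - X](_ : _ = 0) ?subr0//.
under eq_bigr do rewrite mulr_sumr.
rewrite exchange_big/= big1// => k _.
under eq_bigr do rewrite mulrA.
by rewrite -mulr_suml coord_tder ?mul0r//; exact: smooth_tder (sfunP f).
Qed.

Lemma paneitzE m (f : A) : paneitz m (fn f) = fn (pan m f).
Proof.
elim: m => [//|m IHm]; rewrite /= IHm; apply/funext => x.
by rewrite laplacianE.
Qed.

Lemma vf_derivE (X : 'I_n.+1 -> A) (V : sphere R n -> 'rV[R]_n.+1) (f : A) x :
  (forall k, fn (X k) = fun y => V y 0 k) -> dot (V x) (val x) = 0 ->
  vf_deriv V (fn f) x = fn (act X f) x.
Proof.
move=> XV Vx; rewrite /vf_deriv (sdiff_tder (sfunP f) Vx) /act sum_sfunE.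
by apply: eq_bigr => k _; rewrite -(congr1 (fun F => F x) (XV k)).
Qed.

(** Evaluating the conformal Killing equation on the projections of the basis
    vectors. *)
Lemma conformal_killing_conformal (V : sphere R n -> 'rV[R]_n.+1) :
  conformal_killing V -> exists (X : 'I_n.+1 -> A) (s : A),
    conformal X s /\ forall k, fn (X k) = fun y => V y 0 k.
Proof.
move=> [[tV sV] [phi sphi K]].
pose X k : A := sfun_of (sV k); pose s : A := cst 2^-1 * sfun_of sphi.
exists X, s; split => //.
have xX : \sum_i sc_x A i * X i = 0.
  apply: sfun_ext => x; rewrite sum_sfunE -[RHS](tV x).
  by apply: eq_bigr => i _; rewrite mulrC.
split => // i j.
pose e k (x : sphere R n) := tan_proj x (basis_vec R k).
have Ee k l y : fn (proj A k l) y = e k y 0 l.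
  by rewrite /e tan_proj_basis /proj; case: (k == l).
have te k y : dot (e k y) (val y) = 0.
  transitivity (fn (\sum_l sc_x A l * proj A k l) y).
    rewrite sum_sfunE; apply: eq_bigr => l _; rewrite -Ee; exact: mulrC.
  by rewrite sum_x_proj.
have se k : smooth_vf (e k).
  by split => [x|l]; [exact: te|rewrite -(funext (Ee k l)); exact: sfunP].
have XV k : fn (X k) = fun y => V y 0 k by [].
have bracket k l y :
    fn (act X (proj A k l) - act (proj A k) (X l)) y = lie_bracket V (e k) y 0 l.
  rewrite /lie_bracket !mxE -(funext (Ee k l)) -(XV l); congr (_ - _).
    exact: esym (vf_derivE (proj A k l) XV (tV y)).
  have EV l' : fn (proj A k l') = fun z => e k z 0 l' by exact/funext/Ee.
  exact: esym (vf_derivE (X l) EV (te k y)).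
have dot_proj y : fn (\sum_l proj A i l * proj A j l) y = dot (e i y) (e j y).
  by rewrite sum_sfunE; apply: eq_bigr => l _; rewrite -!Ee.
rewrite -lie_form_proj// -/(proj A i j) -sum_projM; apply: sfun_ext => x.
transitivity (lie_metric V (e i) (e j) x).
  rewrite /lie_metric -(funext dot_proj) (vf_derivE _ XV)//.
  congr (_ - _ - _); apply: (etrans (sum_sfunE _ _ x)); apply: eq_bigr => l _;
    by rewrite -Ee -bracket.
rewrite (K _ _ (se i) (se j)) -dot_proj.
have -> : 2 * s = sfun_of sphi.
  by rewrite /s mulrA -(sc_cst_nat A 2) -sc_cstM divff ?sc_cst1 ?mul1r// pnatr_eq0.
by [].
Qed.

Lemma Qcurv_identity m (u : A) : (0 < m)%N -> exists2 Q : A, fn Q = Qcurv m (fn u) &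
  forall (X : 'I_n.+1 -> A) s, conformal X s ->
    int (act X Q * ex (cst n%:R * u)) = 0.
Proof.
move=> m0; have [nm|nm] := eqVneq n m.*2.
  exists (ex (cst (- n%:R) * u) * (cst (m.*2.-1)`!%:R + pan m u)).
    apply/funext => x; rewrite /Qcurv (introT eqP nm) paneitzE -[in expR _]nm.
    by [].
  by move=> X s cX; exact: int_Q_critical cX nm m0.
have a0 : n%:R / 2 - m%:R != 0 :> R.
  rewrite subr_eq0; apply/negP => /eqP nE; move/eqP: nm; apply; apply/eqP.
  by rewrite -(eqr_nat R) -muln2 natrM -nE divfK// pnatr_eq0.
pose w : A := ex (cst (n%:R / 2 - m%:R) * u).
exists (cst (n%:R / 2 - m%:R)^-1 *
   (ex (cst (- (n%:R / 2 + m%:R)) * u) * pan m w)).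
  apply/funext => x; rewrite /Qcurv (negbTE nm) /paneitz_conf mulrC.
  congr (_ * _ / _).
  rewrite (_ : (fun y => _) = fn w) ?paneitzE//.
  by apply/funext => y; rewrite mulr1.
move=> X s cX; rewrite act_cM -mulrA [LHS]sc_intZ.
by rewrite (int_Q_noncritical n1 u cX a0) mulr0.
Qed.

Lemma Q0_constant m : exists c : R, @Q0 R n m = fun=> c.
Proof.
rewrite /Q0; case: eqP => [_|/eqP nm]; first by eexists.
have [d pd] := pan_cst A m 1.
exists (expR 0 * d / (n%:R / 2 - m%:R)); apply/funext => x.
rewrite /Qcurv (negbTE nm) /paneitz_conf mulr0; congr (_ * _ / _).
rewrite (_ : (fun y => _) = fn (cst 1)) ?paneitzE ?pd//.
by apply/funext => y; rewrite mulr0 expR0 mulr1.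
Qed.

(** The curvature increment is the curvature up to an affine change, which the
    integral identity does not see. *)
Lemma Qincr_affine m : exists t c : R, t != 0 /\
  forall u : sphere R n -> R, Qincr m u = fun x => t * (Qcurv m u x - c).
Proof.
have [c Q0c] := Q0_constant m; rewrite /Qincr Q0c.
have [nm|nm] := eqVneq n m.*2.
  by exists 1, c; split; [exact: oner_neq0|move=> u; apply/funext => x; rewrite mul1r].
exists (n%:R / 2 - m%:R), c; split => //.
rewrite subr_eq0; apply/negP => /eqP nE; move/eqP: nm; apply; apply/eqP.
by rewrite -(eqr_nat R) -muln2 natrM -nE divfK// pnatr_eq0.
Qed.

End kazdan_warner.

Theorem theorem1 (R : realType) (m n : nat) (hmn : admissible m n) :
  (forall (u q : sphere R n -> R) (X : sphere R n -> 'rV[R]_n.+1),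
     smooth u -> smooth q -> conformal_killing X ->
     Qgraph m (u, q) ->
     sphere_int (fun x => vf_deriv X q x * expR (n%:R * u x)) = 0) /\
  (forall (z : sphere R n -> R) (c : R),
     Lambda1 z -> z <> (fun=> 0) ->
     ~ exists2 u : sphere R n -> R, smooth u &
         Qcurv m u = (fun x => z x + c)).
Proof.
have [m0 n1 _] := hmn; split.
  move=> u q V su sq cV [_ _ [-> qE]].
  have [X [s [cX XV]]] := conformal_killing_conformal n1 cV.
  have [[tV _] _] := cV.
  pose U : smooth_calculus R n1 := sfun_of su.
  have [Q QE Q0] := Qcurv_identity U m0.
  have [t [k [t0 affine]]] := Qincr_affine R n1 m.
  pose q' : smooth_calculus R n1 := sc_cst _ t * (Q - sc_cst _ k).
  have q'E : @sfun_val R n q' = q.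
    by rewrite -qE affine (_ : Qcurv m u = @sfun_val R n Q).
  rewrite -[RHS](mulr0 t) -(Q0 X s cX) -sc_intZ.
  congr sphere_int; apply/funext => x; rewrite -q'E (vf_derivE _ XV)//.
  rewrite mulrA -act_cM; congr (_ * _).
  by rewrite /q' !act_cM actD actN act_c subr0.
move=> z c [sz Lz] z0 [u su Qz]; apply: z0.
pose Z : smooth_calculus R n1 := sfun_of sz; pose U : smooth_calculus R n1 := sfun_of su.
have LZ : lapl Z = - n%:R * Z.
  apply/eqP; rewrite mulNr -subr_eq0 opprK addrC -[lapl Z]opprK subr_eq0; apply/eqP.
  apply: sfun_ext => x; rewrite -(sc_cst_nat (smooth_calculus R n1) n).
  have := Lz x; rewrite -[z in laplacian z]/(@sfun_val R n Z) laplacianE => /esym.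
  exact.
have [Q QE Q0] := Qcurv_identity U m0.
have QZ : Q = Z + sc_cst _ c by apply: val_inj; rewrite [LHS]QE Qz.
pose e : smooth_calculus R n1 := sc_exp (sc_cst _ (n%:R / 2) * U).
have ee : sc_exp (sc_cst _ n%:R * U) = e * e.
  by rewrite -sc_expD -mulrDl -sc_cstD; congr (sc_exp (sc_cst _ _ * U)); field.
have := Q0 _ _ (eigen_conformal LZ); rewrite QZ actD act_c addr0 ee.
move=> /(eigen_act_zero LZ) eDZ.
have DZ i : sc_D i Z = 0.
  have : sc_exp (- (sc_cst _ (n%:R / 2) * U)) * (e * sc_D i Z) = 0 by rewrite eDZ mulr0.
  by rewrite mulrA -sc_expD addNr sc_exp0 mul1r.
have nZ : sc_cst _ n%:R * Z = 0.
  rewrite sc_cst_nat; apply/eqP; rewrite -oppr_eq0 -mulNr -LZ; apply/eqP.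
  by rewrite /lapl big1// => i _; rewrite DZ sc_der0.
have n0 : n%:R != 0 :> R by rewrite pnatr_eq0 -lt0n ltnW.
have Z0 : Z = 0 by exact: (sc_cst_cancel n0 nZ).
by rewrite -[z]/(@sfun_val R n Z) Z0.
Qed.
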